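(* Let $\mathbf{k}$ be a field which is either finite or algebraically closed, of arbitrary characteristic. Let $V$ be a $\mathbf{k}$-vector space of finite dimension $D\ge 2$ and let $Q:V\to\mathbf{k}$ be a nondegenerate quadratic form. Then the map $(X^*,N)\mapsto 1+N$, from the set of pairs $(X^*,N)$ where $X^*$ is a $Q$-filtration of $V$ and $N\in E^{\ge2}_*X^*$, to the set of unipotent elements of $SO_Q$, is well defined and bijective. Equivalently: for every unipotent element $g\in SO_Q$ there is a unique $Q$-filtration $X^*$ of $V$ such that $g-1\in E^{\ge2}_*X^*$.
   Context: Let $\langle x,y\rangle=Q(x+y)-Q(x)-Q(y)$ be the symmetric bilinear form associated to $Q$, and $R=\{x\in V:\langle x,V\rangle=0\}$ its radical. $Q$ is called nondegenerate if $Q|_R:R\to\mathbf{k}$ is injective. For a subspace $W\subset V$, $W^\perp=\{x\in V:\langle x,W\rangle=0\}$. $O_Q=\{T\in GL(V):Q(Tx)=Q(x)\ \forall x\}$. If $\mathbf{k}$ is algebraically closed, $SO_Q$ is the identity component of $O_Q$; if $\mathbf{k}$ is finite, $SO_Q=O_Q\cap SO_{\tilde Q}$ where $\tilde Q$ is the extension of $Q$ to an algebraic closure of $\mathbf{k}$. An element is unipotent if all its eigenvalues equal $1$. Let $\tilde{\mathcal M}_Q$ be the set of nilpotent $N\in\mathrm{End}(V)$ with $Q(Nx)=-\langle x,Nx\rangle$ for all $x\in V$ (equivalently, $1+N$ is a unipotent element of $O_Q$). A $Q$-filtration of $V$ is a family $X^*=(X^{\ge a})_{a\in\mathbb Z}$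 of subspaces with $X^{\ge a+1}\subset X^{\ge a}$ for all $a$, $X^{\ge a}=0$ for $a\gg0$, $X^{\ge a}=V$ for $a\ll0$, and such that for every $a\ge1$: $Q|_{X^{\ge a}}=0$ and $X^{\ge 1-a}=(X^{\ge a})^\perp$. Put $\mathrm{gr}^aX^*=X^{\ge a}/X^{\ge a+1}$ and $\mathrm{gr}X^*=\bigoplus_a\mathrm{gr}^aX^*$. For $x_b\in\mathrm{gr}^bX^*$ let $\dot x_b$ denote a representative in $X^{\ge b}$. Define a quadratic form $\bar Q$ on $\mathrm{gr}X^*$ by $\bar Q(\sum_a x_a)=Q(\dot x_0)+\sum_{a\ge1}\langle\dot x_{-a},\dot x_a\rangle$; its associated bilinear form (again written $\langle,\rangle$) is $\langle\sum_a x_a,\sum_b x'_b\rangle=\sum_{a+b=0}\langle\dot x_a,\dot x'_b\rangle$ (these are well defined). $E^{\ge2}X^*$ is the set of $N\in\tilde{\mathcal M}_Q$ with $NX^{\ge a}\subset X^{\ge a+2}$ for all $a$. Such $N$ induces maps $\mathrm{gr}^aX^*\to\mathrm{gr}^{a+2}X^*$, whose direct sum is denoted $\bar N$. $E^{\ge2}_*X^*$ is the set of $N\in E^{\ge2}X^*$ such that: (i) for every even $a\ge0$, the quadratic form $\mathrm{gr}^{-a}X^*\to\mathbf{k}$, $x\mapsto\bar Q(\bar N^{a/2}x)$, is nondegenerate (in the sense above: injective on the radical of its associated bilinear form); (ii) for every odd $a\ge1$, the (alternating) bilinear form $\mathrm{gr}^{-a}X^*\times\mathrm{gr}^{-a}X^*\to\mathbf{k}$,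 $(x,y)\mapsto\langle x,\bar N^ay\rangle$, has zero radical. *)

(* Defs.v *)
From HB Require Import structures.
From mathcomp Require Import all_boot all_order all_algebra.
From mathcomp Require Import mpoly.
Set Implicit Arguments. Unset Strict Implicit. Unset Printing Implicit Defensive.
Import Order.TTheory GRing.Theory Num.Theory.
Local Open Scope ring_scope.

(* V = 'rV[F]_n (row vectors), endomorphisms = 'M[F]_n acting on the right:
   T x := x *m T.  Subspaces of V are represented by matrices via their row
   space (mxalgebra, scope %MS). *)

Section Forms.
Variables (F : fieldType) (n : nat).
Implicit Types (q : 'rV[F]_n -> F) (x y z : 'rV[F]_n) (g N : 'M[F]_n).

Definition bil q x y : F := q (x + y) - q x - q y.

Definition is_qform q : Prop :=
  (forall (a : F) x, q (a *: x) = a ^+ 2 * q x) /\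
  (forall x y z, bil q (x + y) z = bil q x z + bil q y z) /\
  (forall (a : F) x y, bil q (a *: x) y = a * bil q x y).

Definition in_radical q x : Prop := forall y, bil q x y = 0.

Definition nondeg q : Prop :=
  forall x y, in_radical q x -> in_radical q y -> q x = q y -> x = y.

Definition O_Q q (g : 'M[F]_n) : Prop :=
  g \in unitmx /\ forall x, q (x *m g) = q x.

Definition unipotent (g : 'M[F]_n) : Prop :=
  char_poly g = ('X - 1) ^+ n.

Definition mx_eval (p : {mpoly F[n * n]}) (A : 'M[F]_n) : F :=
  p.@[fun i => mxvec A 0 i].

Definition zclosed_in (T C : 'M[F]_n -> Prop) : Prop :=
  exists P : {mpoly F[n * n]} -> Prop,
    forall A, C A <-> (T A /\ forall p, P p -> mx_eval p A = 0).

Definition zconnected (T : 'M[F]_n -> Prop) : Prop :=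
  forall C1 C2 : 'M[F]_n -> Prop,
    zclosed_in T C1 -> zclosed_in T C2 ->
    (forall A, T A -> C1 A \/ C2 A) ->
    (forall A, ~ (C1 A /\ C2 A)) ->
    (forall A, T A -> C1 A) \/ (forall A, T A -> C2 A).

Definition in_identity_component (S : 'M[F]_n -> Prop) (g : 'M[F]_n) : Prop :=
  exists T : 'M[F]_n -> Prop,
    (forall A, T A -> S A) /\ T 1%:M /\ T g /\ zconnected T.

End Forms.

Definition alg_closed (F : fieldType) : Prop := GRing.closed_field_axiom F.
Definition finite_field (F : fieldType) : Prop := exists s : seq F, forall x, x \in s.

Definition algebraic_over (F : fieldType) (L : fieldType) (f : {rmorphism F -> L}) : Prop :=
  forall x : L, exists p : {poly F}, p != 0 /\ root (map_poly f p) x.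

Definition Qext (F : fieldType) (L : fieldType) (f : {rmorphism F -> L}) (n : nat)
    (q : 'rV[F]_n -> F) : 'rV[L]_n -> L :=
  fun x => \sum_(i < n) f (q (delta_mx 0 i)) * x 0 i ^+ 2 +
           \sum_(i < n) \sum_(j < n | (i < j)%N)
              f (bil q (delta_mx 0 i) (delta_mx 0 j)) * x 0 i * x 0 j.

Definition SO_Q (F : fieldType) (n : nat) (q : 'rV[F]_n -> F) (g : 'M[F]_n) : Prop :=
  (alg_closed F -> in_identity_component (O_Q q) g) /\
  (finite_field F ->
     O_Q q g /\
     forall (L : closedFieldType) (f : {rmorphism F -> L}),
       algebraic_over f ->
       in_identity_component (O_Q (Qext f q)) (map_mx f g)).

Section Filtrations.
Variables (F : fieldType) (n : nat) (q : 'rV[F]_n -> F).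

Definition Qfiltration (X : int -> 'M[F]_n) : Prop :=
  (forall a : int, (X (a + 1)%R <= X a)%MS) /\
  (exists a0 : int, forall a, a0 <= a -> (X a <= (0 : 'M[F]_n))%MS) /\
  (exists a1 : int, forall a, a <= a1 -> row_full (X a)) /\
  (forall a : int, 1 <= a ->
     (forall x : 'rV[F]_n, (x <= X a)%MS -> q x = 0) /\
     (forall x : 'rV[F]_n,
        (x <= X (1 - a)%R)%MS <-> (forall y : 'rV[F]_n, (y <= X a)%MS -> bil q x y = 0))).

Definition Mtilde (N : 'M[F]_n) : Prop :=
  (exists k, N ^+ k = 0) /\ forall x : 'rV[F]_n, q (x *m N) = - bil q x (x *m N).

Definition E2 (X : int -> 'M[F]_n) (N : 'M[F]_n) : Prop :=
  Mtilde N /\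
  forall (a : int) (x : 'rV[F]_n), (x <= X a)%MS -> (x *m N <= X (a + 2)%R)%MS.

(* A quadratic function h on W that descends to W/W' is nondegenerate on
   W/W' (its restriction to the radical of its bilinear form is injective),
   written on representatives. *)
Definition qnondeg_quot (W W' : 'M[F]_n) (h : 'rV[F]_n -> F) : Prop :=
  let b := fun x y => h (x + y) - h x - h y in
  forall x y : 'rV[F]_n, (x <= W)%MS -> (y <= W)%MS ->
    (forall z, (z <= W)%MS -> b x z = 0) ->
    (forall z, (z <= W)%MS -> b y z = 0) ->
    h x = h y -> ((x - y)%R <= W')%MS.

(* A bilinear form b on W that descends to W/W' has zero radical on W/W'. *)
Definition bnondeg_quot (W W' : 'M[F]_n) (b : 'rV[F]_n -> 'rV[F]_n -> F) : Prop :=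
  forall x : 'rV[F]_n, (x <= W)%MS ->
    (forall y, (y <= W)%MS -> b x y = 0) -> (x <= W')%MS.

(* E^{>=2}_* X^*; gr^{-a} = X(-a) / X(-a+1); for x in X(-a) the class of
   bar N^k x is the class of x N^k, and bar Q on gr^0 is Q(lift), the pairing
   gr^{-a} x gr^a is <lift, lift>. *)
Definition Estar (X : int -> 'M[F]_n) (N : 'M[F]_n) : Prop :=
  E2 X N /\
  (forall a : nat, ~~ odd a ->
     qnondeg_quot (X (- (a%:Z))) (X (- (a%:Z) + 1)) (fun x => q (x *m N ^+ a./2))) /\
  (forall a : nat, odd a ->
     bnondeg_quot (X (- (a%:Z))) (X (- (a%:Z) + 1)) (fun x y => bil q x (y *m N ^+ a))).

End Filtrations.

(* Main.v *)
Require Import Defs.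
From HB Require Import structures.
From mathcomp Require Import all_boot all_order all_algebra closed_field.
From mathcomp Require Import mpoly ring zify.
From Stdlib Require Import Classical ClassicalEpsilon FunctionalExtensionality.
Set Implicit Arguments. Unset Strict Implicit. Unset Printing Implicit Defensive.
Import Order.TTheory GRing.Theory Num.Theory.
Local Open Scope ring_scope.

(* Endomorphisms act on row vectors from the right; write N = g - 1, q for the
   quadratic form, b for its polar form and Y_a = X^{-a}, for a >= 0.

   The conditions defining E_*^{>=2} say exactly that
     Y_(a-1) = {x in Y_a : b(x, Y_a N^a) = 0, and q(x N^(a/2)) = 0 if a is even},
   and X^(a+1) is the set of singular vectors of the orthogonal of Y_a.  Starting
   from Y_a = V for a large, this recursion determines the filtration, whence
   uniqueness.  For existence one checks by descending induction that Y_a is the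
   orthogonal of a totally singular subspace.  The orthogonal of Y_(a-1) is spanned
   by that of Y_a, by Y_a N^a and, for a even, by vectors x N^(a-1); these are
   singular as soon as a >= 3.  The only obstruction occurs for a = 2 in
   characteristic 2 when b is nondegenerate: there a nonsingular vector v = xN of
   the orthogonal of Y_1 makes g times the reflection in v lie in the unipotent
   radical of a parabolic subgroup, so that g has Dickson invariant 1.

   The Dickson invariant is a polynomial function on O_q with values in {0, 1},
   hence it vanishes on the identity component.  Conversely, if g stabilises a
   totally singular L and acts trivially on L^perp / L, a one-parameter group
   contracts g to its Levi part, which is joined to 1 by a polynomial path; with
   L = X^1 this puts 1 + N in the identity component. *)

(** * Quadratic forms as matrices *)

Section Form.
Variables (K : fieldType) (n : nat).
Implicit Types (A C N g : 'M[K]_n) (x y z : 'rV[K]_n).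

Definition qmx A x : K := (x *m A *m x^T) 0 0.
Definition bmx A x y : K := (x *m (A + A^T) *m y^T) 0 0.

Lemma mx11_tr m (u : 'rV[K]_m) (C : 'M[K]_m) (v : 'rV[K]_m) :
  (u *m C *m v^T) 0 0 = (v *m C^T *m u^T) 0 0.
Proof.
by rewrite -[in RHS](trmxK v) -!trmx_mul mulmxA [RHS]mxE.
Qed.

Lemma qmxD A x y : qmx A (x + y) = qmx A x + qmx A y + bmx A x y.
Proof.
rewrite /qmx /bmx [(x + y)^T]linearD !mulmxDl !mulmxDr !mulmxDl.
rewrite ![(_ + _ : 'M_1) 0 0]mxE [(y *m A *m x^T) 0 0]mx11_tr.
ring.
Qed.

Lemma qmxZ A a x : qmx A (a *: x) = a ^+ 2 * qmx A x.
Proof. by rewrite /qmx linearZ /= -!scalemxAl -!scalemxAr scalerA mxE. Qed.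

Lemma qmx0 A : qmx A 0 = 0.
Proof. by rewrite /qmx !mul0mx mxE. Qed.

Lemma bmxC A x y : bmx A x y = bmx A y x.
Proof. by rewrite /bmx mx11_tr linearD /= trmxK [_^T + _]addrC. Qed.

Lemma bmxDl A x y z : bmx A (x + y) z = bmx A x z + bmx A y z.
Proof. by rewrite /bmx !mulmxDl mxE. Qed.

Lemma bmxDr A x y z : bmx A z (x + y) = bmx A z x + bmx A z y.
Proof. by rewrite !(bmxC A z) bmxDl. Qed.

Lemma bmxZl A a x y : bmx A (a *: x) y = a * bmx A x y.
Proof. by rewrite /bmx -!scalemxAl mxE. Qed.

Lemma bmxZr A a x y : bmx A x (a *: y) = a * bmx A x y.
Proof. by rewrite !(bmxC A x) bmxZl. Qed.

Lemma bmxNl A x y : bmx A (- x) y = - bmx A x y.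
Proof. by rewrite -scaleN1r bmxZl mulN1r. Qed.

Lemma bmxNr A x y : bmx A x (- y) = - bmx A x y.
Proof. by rewrite !(bmxC A x) bmxNl. Qed.

Lemma bmx0r A x : bmx A x 0 = 0.
Proof. by rewrite -(scale0r 0) bmxZr mul0r. Qed.

Lemma bmx0l A x : bmx A 0 x = 0.
Proof. by rewrite bmxC bmx0r. Qed.

Lemma bmxx A x : bmx A x x = qmx A x *+ 2.
Proof. by rewrite /bmx mulmxDr mulmxDl mxE -[X in _ + X]mx11_tr. Qed.

Lemma qmxN A x : qmx A (- x) = qmx A x.
Proof. by rewrite -scaleN1r qmxZ sqrrN expr1n mul1r. Qed.

Lemma bil_qmx A x y : bil (qmx A) x y = bmx A x y.
Proof. by rewrite /bil qmxD; ring. Qed.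

(** Many matrices give the same form. The upper triangular one is canonical and is the one
    underlying [Qext]; the later hypothesis [qform_mx (qmx A) = A] says that [A] is this
    representative. *)
Definition qform_mx (q : 'rV[K]_n -> K) : 'M[K]_n :=
  \matrix_(i, j) if i == j then q (delta_mx 0 i)
    else if (i < j)%N then bil q (delta_mx 0 i) (delta_mx 0 j) else 0.

Lemma delta_mx_entry A (i j : 'I_n) :
  (delta_mx 0 i *m A *m (delta_mx 0 j)^T) (0 : 'I_1) (0 : 'I_1) = A i j.
Proof. by rewrite -rowE trmx_delta -colE !mxE. Qed.

Lemma qmx_delta A i : qmx A (delta_mx 0 i) = A i i.
Proof. by rewrite /qmx delta_mx_entry. Qed.

Lemma bmx_delta A i j : bmx A (delta_mx 0 i) (delta_mx 0 j) = A i j + A j i.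
Proof. by rewrite /bmx delta_mx_entry !mxE. Qed.

Lemma qform_mxE q : is_qform q -> q = qmx (qform_mx q).
Proof.
move=> [qZ [qDl qZl]].
have qC x y : bil q x y = bil q y x by rewrite /bil [y + x]addrC; ring.
have q2 x : bil q x x = q x *+ 2.
  by rewrite /bil -mulr2n -scaler_nat qZ; ring.
have qb i j : bil q (delta_mx 0 i) (delta_mx 0 j)
            = bmx (qform_mx q) (delta_mx 0 i) (delta_mx 0 j).
  rewrite bmx_delta !mxE eq_sym; case: eqVneq => [->|ne_ij]; first by rewrite q2.
  case: ltngtP => [||e]; rewrite ?addr0 ?add0r //; last first.
    by case/eqP: ne_ij; apply: val_inj.
have bE x y : bil q x y = bmx (qform_mx q) x y.
  rewrite {1 2}[x]row_sum_delta; apply: (big_ind (fun x => bil q x y = bmx _ x y)).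
  - by rewrite -(scale0r 0) qZl bmxZl !mul0r.
  - by move=> u v hu hv; rewrite qDl bmxDl hu hv.
  move=> i _; rewrite qZl bmxZl; congr (_ * _).
  rewrite {1 2}[y]row_sum_delta; apply: (big_ind (fun y => bil q _ y = bmx _ _ y)).
  - by rewrite -(scale0r 0) qC bmxC qZl bmxZl !mul0r.
  - by move=> u v hu hv; rewrite qC bmxC qDl bmxDl qC hu qC hv !(bmxC _ (delta_mx _ _)).
  by move=> j _; rewrite qC bmxC qZl bmxZl qC bmxC qb.
apply: functional_extensionality => x.
rewrite {1 2}[x]row_sum_delta; apply: (big_ind (fun x => q x = qmx _ x)).
- by rewrite -(scale0r 0) qZ qmxZ expr0n /= !mul0r.
- by move=> u v hu hv; rewrite qmxD -bE -hu -hv /bil; ring.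
by move=> i _; rewrite qZ qmxZ qmx_delta mxE eqxx.
Qed.

End Form.

Lemma Qext_qmx (F L : fieldType) (f : {rmorphism F -> L}) n (q : 'rV[F]_n -> F) :
  Qext f q = qmx (map_mx f (qform_mx q)).
Proof.
apply: functional_extensionality => x; rewrite /Qext /qmx mxE.
under [RHS]eq_bigr do rewrite mxE big_distrl /=.
rewrite exchange_big -big_split /=; apply: eq_bigr => i _.
rewrite [RHS](bigID (fun j : 'I_n => (i < j)%N)) /= [RHS]addrC; congr (_ + _).
  rewrite (bigD1 i) ?ltnn //= big1 ?addr0 => [|j /andP[lij ne]].
    by rewrite !mxE eqxx expr2; ring.
  by rewrite !mxE eq_sym (negPf ne) (negPf lij) rmorph0 mulr0 mul0r.
apply: eq_bigr => j lij; rewrite !mxE lij.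
case: eqVneq lij => [->|_ _]; first by rewrite ltnn.
by ring.
Qed.

(** * Orthogonal subspaces *)

Section Perp.
Variables (K : fieldType) (n : nat) (A : 'M[K]_n).
Implicit Types (x y z : 'rV[K]_n).
Local Notation B := (A + A^T).

Definition perp m (U : 'M[K]_(m, n)) : 'M[K]_n := kermx (B *m U^T).
Definition radmx : 'M[K]_n := kermx B.

Lemma perpP m (U : 'M[K]_(m, n)) x :
  reflect (forall y, (y <= U)%MS -> bmx A x y = 0) (x <= perp U)%MS.
Proof.
apply: (iffP sub_kermxP) => [xU0 y /submxP[d ->]|xU].
  by rewrite /bmx trmx_mul mulmxA -[x *m _ *m _]mulmxA xU0 mul0mx mxE.
apply/rowP => i; rewrite [RHS]mxE -[RHS](xU (row i U)) ?row_sub //.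
by rewrite /bmx tr_row colE !mulmxA -colE [RHS]mxE.
Qed.

Lemma radmxP x : reflect (forall y, bmx A x y = 0) (x <= radmx)%MS.
Proof.
have <- : perp 1%:M = radmx by rewrite /perp trmx1 mulmx1.
by apply: (iffP (perpP _ _)) => [h y|h y _]; [apply: h (submx1 _)|apply: h].
Qed.

Lemma perpS m1 m2 (U : 'M[K]_(m1, n)) (W : 'M[K]_(m2, n)) :
  (U <= W)%MS -> (perp W <= perp U)%MS.
Proof.
move=> UW; apply/rV_subP => x /perpP xW; apply/perpP => y yU.
exact: xW (submx_trans yU UW).
Qed.

Lemma radmx_perp m (U : 'M[K]_(m, n)) : (radmx <= perp U)%MS.
Proof. by apply/rV_subP => x /radmxP xR; apply/perpP. Qed.

Lemma sub_perpK m (U : 'M[K]_(m, n)) : (U <= perp (perp U))%MS.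
Proof.
apply/rV_subP => x xU; apply/perpP => y /perpP yU.
by rewrite bmxC yU.
Qed.

(** The orthogonal is the kernel of [B *m U^T], and [U *m B] has rank [\rank U] minus the rank of
    the intersection of [U] with the radical. *)
Lemma rank_perp m (U : 'M[K]_(m, n)) : (radmx <= U)%MS ->
  (\rank (perp U) + \rank U = n + \rank radmx)%N.
Proof.
move=> RU; rewrite mxrank_ker -mxrank_tr trmx_mul trmxK linearD /= trmxK [_^T + _]addrC.
have := mxrank_mul_ker U B.
rewrite (eqmx_rank (_ : (U :&: kermx B)%MS == radmx)%MS); last first.
  by rewrite capmxSr sub_capmx RU submx_refl.
have : (\rank (U *m B) <= n)%N by apply: rank_leq_col.
by move=> le_rank <-; rewrite addnA subnK.
Qed.

Lemma perpK m (U : 'M[K]_(m, n)) : (radmx <= U)%MS -> (perp (perp U) :=: U)%MS.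
Proof.
move=> RU; apply/eqmxP; rewrite andbC -(geq_leqif (mxrank_leqif_eq (sub_perpK U))).
have := rank_perp RU; have := rank_perp (radmx_perp U); lia.
Qed.

Lemma perp_addrad m (U : 'M[K]_(m, n)) : (perp (U + radmx)%MS :=: perp U)%MS.
Proof.
apply/eqmxP/andP; split; first exact: perpS (addsmxSl _ _).
apply/rV_subP => x /perpP xU; apply/perpP => _ /sub_addsmxP[[d e] /= ->].
rewrite bmxDr xU ?submxMl // add0r bmxC.
by have /radmxP -> : (e *m radmx <= radmx)%MS by apply: submxMl.
Qed.

Lemma perp_perp m (U : 'M[K]_(m, n)) : (perp (perp U) :=: U + radmx)%MS.
Proof.
apply: eqmx_trans (perpK (addsmxSr _ _)).
by apply/eqmxP/andP; split; apply: perpS; rewrite perp_addrad.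
Qed.

Lemma perp_adds m1 m2 (U : 'M[K]_(m1, n)) (W : 'M[K]_(m2, n)) x :
  (x <= perp (U + W)%MS)%MS = (x <= perp U)%MS && (x <= perp W)%MS.
Proof.
apply/idP/andP => [xUW|[/perpP xU /perpP xW]].
  by split; apply: submx_trans xUW (perpS _); rewrite ?addsmxSl ?addsmxSr.
apply/perpP => _ /sub_addsmxP[[d e] /= ->].
by rewrite bmxDr xU ?xW ?submxMl ?addr0.
Qed.

(** Bounds an orthogonal from above by duality: orthogonals reverse the inclusion, and a double
    orthogonal only adds the radical. *)
Lemma perp_sub_adds m m1 m2 (Y : 'M[K]_(m, n)) (U : 'M[K]_(m1, n)) (W : 'M[K]_(m2, n)) :
  (forall x, (x <= perp U)%MS -> (x <= perp W)%MS -> (x <= Y)%MS) ->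
  (perp Y <= U + W + radmx)%MS.
Proof.
move=> h; rewrite -(perp_perp (U + W)%MS) perpS //.
by apply/rV_subP => x; rewrite perp_adds => /andP[/h]; apply.
Qed.

End Perp.

(** * Subspaces cut out by predicates *)

Section Span.
Variables (K : fieldType) (n : nat).
Implicit Types (P : 'rV[K]_n -> Prop) (x : 'rV[K]_n).

Definition subspace P := P 0 /\ forall a x y, P x -> P y -> P (a *: x + y).

(** The levels of the filtration involve quadratic conditions, so they arise as predicates; a matrix
    with that row space is chosen by [epsilon]. *)
Definition spanp P : 'M[K]_n :=
  epsilon (inhabits 0) (fun U : 'M[K]_n => forall x, (x <= U)%MS <-> P x).

(** As long as [P] has a vector outside [U], adding it raises the rank, which can happen at most [n]
    times. *)
Lemma spanpP P x : subspace P -> (x <= spanp P)%MS <-> P x.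
Proof.
move=> [P0 PD]; apply: (epsilon_spec (inhabits 0) (fun U : 'M[K]_n => forall x, (x <= U)%MS <-> P x)).
suff grow k (U : 'M[K]_n) : (n - \rank U <= k)%N -> (forall x, (x <= U)%MS -> P x) ->
    exists U : 'M[K]_n, forall x, (x <= U)%MS <-> P x.
  by apply: (grow n 0); rewrite ?leq_subr // => y /[!submx0] /eqP ->.
elim: k U => [|k IH] U rU UP; have [PU|/not_all_ex_not[y nPy]] := classic (forall x, P x -> (x <= U)%MS).
- by exists U => y; split; [exact: UP|exact: PU].
- case: nPy => _; apply: submx_full; rewrite /row_full.
  by have := rank_leq_row U; move: rU; lia.
- by exists U => y; split; [exact: UP|exact: PU].
have [Py nUy] := imply_to_and _ _ nPy.
apply: (IH (U + y)%MS) => [|z].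
  have : (U < U + y)%MS.
    by rewrite /ltmx addsmxSl; apply/negP => /(submx_trans (addsmxSr U y)).
  by move/rank_ltmx; move: rU; lia.
case/sub_addsmxP => -[d e] /= ->; rewrite addrC.
rewrite [e]mx11_scalar mul_scalar_mx; apply: PD => //.
by apply: UP; rewrite submxMl.
Qed.

End Span.

(** * Zariski connectedness *)

Definition infinite_field (L : fieldType) := forall s : seq L, exists t, t \notin s.

Lemma alg_closed_infinite (L : fieldType) : alg_closed L -> infinite_field L.
Proof.
move=> Lcl [|a s]; first by exists 0.
pose p : {poly L} := \prod_(b <- a :: s) ('X - b%:P).
(* A root of the monic polynomial [p + 1]; it avoids the list because [p] vanishes there. *)
have [t ht] := Lcl (size s).+1 (fun i => - (p + 1)`_i) isT.
have sz_p : size p = (size s).+2 by rewrite size_prod_XsubC.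
exists t; apply/negP => t_in.
have : (p + 1).[t] = 0.
  have sz_p1 : size (p + 1) = (size s).+2 by rewrite size_polyDl sz_p ?size_poly1.
  rewrite horner_coef sz_p1 big_ord_recr /= ht.
  have -> : (p + 1)`_(size s).+1 = 1.
    rewrite coefD coefC addr0; have /monicP := monic_prod_XsubC (a :: s) xpredT id.
    by rewrite /lead_coef -/p sz_p.
  rewrite mul1r -big_split big1 // => i _; rewrite /=; ring.
rewrite hornerD hornerC (_ : p.[t] = 0) ?add0r => [/eqP|]; first by rewrite oner_eq0.
by apply/rootP; rewrite root_prod_XsubC.
Qed.

Section Connected.
Variables (L : fieldType) (n : nat).
Implicit Types (S T C : 'M[L]_n -> Prop) (p : {mpoly L[n * n]}).

Definition poly_path (gam : L -> 'M[L]_n) :=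
  exists k (M : nat -> 'M[L]_n), forall t, gam t = \sum_(i < k) t ^+ i *: M i.

Lemma mx_eval_path gam p : poly_path gam ->
  exists r : {poly L}, forall t, mx_eval p (gam t) = r.[t].
Proof.
move=> [k [M gamE]].
pose e (j : 'I_(n * n)) : {poly L} := \poly_(i < k) mxvec (M i) 0 j.
exists (\sum_(m <- msupp p) p@_m *: \prod_j e j ^+ m j) => t.
rewrite /mx_eval mevalE horner_sum; apply: eq_bigr => m _.
rewrite hornerZ horner_prod; congr (_ * _); apply: eq_bigr => j _.
rewrite horner_exp horner_poly gamE; congr (_ ^+ _).
rewrite linear_sum summxE; apply: eq_bigr => i _.
by rewrite linearZ mxE mulrC.
Qed.

(** If neither closed set contains the path, each has an equation that restricts to a nonzero
    polynomial in [t]. The product of the two vanishes for every [t], which an infinite field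
    excludes. *)
Lemma zconnected_path gam : infinite_field L -> poly_path gam ->
  zconnected (fun A => exists t, A = gam t).
Proof.
move=> Linf gamP C1 C2 [P1 C1E] [P2 C2E] cover disj.
apply: NNPP => /not_or_and[nC1 nC2].
have bad (C : 'M[L]_n -> Prop) (P : {mpoly L[n * n]} -> Prop) :
    (forall A, C A <-> (exists t, A = gam t) /\ forall p, P p -> mx_eval p A = 0) ->
    ~ (forall A, (exists t, A = gam t) -> C A) ->
    exists2 r : {poly L}, r != 0 & forall t, C (gam t) -> r.[t] = 0.
  move=> CE nC; have [A hA] := not_all_ex_not _ _ nC.
  have [[t0 At0] nCA] := imply_to_and _ _ hA; subst A.
  have [p hp] : exists p, ~ (P p -> mx_eval p (gam t0) = 0).
    by apply: not_all_ex_not => h; apply: nCA; apply/CE; split=> //; exists t0.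
  have [Pp nz] := imply_to_and _ _ hp.
  have [r rE] := mx_eval_path p gamP.
  exists r; last by move=> t /CE[_ h]; rewrite -rE h.
  by apply/eqP => r0; apply: nz; rewrite rE r0 horner0.
have [r1 nz1 h1] := bad _ _ C1E nC1; have [r2 nz2 h2] := bad _ _ C2E nC2.
have nz : r1 * r2 != 0 by rewrite mulf_neq0.
have [s hs] : exists s : seq L, forall t, root (r1 * r2) t -> t \in s.
  suff H m (r : {poly L}) : r != 0 -> (size r <= m)%N ->
     exists s : seq L, forall t, root r t -> t \in s by apply: (H _ _ nz (leqnn _)).
  elim: m r => [|m IH] r nzr; first by rewrite leqn0 size_poly_eq0 (negPf nzr).
  move=> szr; have [[a ra]|nor] := classic (exists a, root r a); last first.
    by exists [::] => t rt; case: nor; exists t.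
  have /factor_theorem[u uE] := ra.
  have nzu : u != 0 by apply: contraNneq nzr => u0; rewrite uE u0 mul0r.
  have [|s hs] := IH u nzu.
    by move: szr; rewrite uE size_Mmonic ?monicXsubC // size_XsubC addn2.
  exists (a :: s) => t; rewrite uE rootM root_XsubC inE => /orP[/hs ->|->//].
  by rewrite orbT.
have [t /negP nt] := Linf s; apply: nt; apply: hs.
rewrite rootM; apply/orP; case: (cover (gam t)); first by exists t.
  by move=> /h1/eqP; left.
by move=> /h2/eqP; right.
Qed.

Lemma in_identity_component1 S : S 1%:M -> in_identity_component S 1%:M.
Proof.
move=> S1; exists (fun A => A = 1%:M); split; first by move=> A ->.
do 2![split=> //]; move=> C1 C2 _ _ cover _.
by case: (cover 1%:M erefl) => h; [left|right] => A ->.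
Qed.

Lemma zclosed_sub S T C : (forall A, S A -> T A) ->
  zclosed_in T C -> zclosed_in S (fun A => S A /\ C A).
Proof.
move=> ST [P CE]; exists P => A; rewrite CE.
by split=> [[SA [_ h]]|[SA h]]; split=> //; split=> //; apply: ST.
Qed.

(** The path and the connected set joining 1 to [gam 0] share the point [gam 0], so their union is
    connected. *)
Lemma in_identity_component_path S gam : infinite_field L -> poly_path gam ->
  (forall t, S (gam t)) ->
  in_identity_component S (gam 0) -> in_identity_component S (gam 1).
Proof.
move=> Linf gamP Sgam [T [TS [T1 [T0 Tconn]]]].
pose I A := exists t, A = gam t.
have IT A : I A -> T A \/ I A by right.
have TT A : T A -> T A \/ I A by left.
exists (fun A => T A \/ I A); split; first by move=> A [/TS|[t ->]].
split; [by left|split; [by right; exists 1|]].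
move=> C1 C2 cl1 cl2 cover disj.
have disj' (S' : 'M[L]_n -> Prop) A : ~ ((S' A /\ C1 A) /\ (S' A /\ C2 A)).
  by move=> [[_ ?] [_ ?]]; apply: (disj A).
have cov' (S' : 'M[L]_n -> Prop) : (forall A, S' A -> T A \/ I A) ->
    forall A, S' A -> (S' A /\ C1 A) \/ (S' A /\ C2 A).
  by move=> h A S'A; case: (cover A (h A S'A)); [left|right].
have i0 : I (gam 0) by exists 0.
have := zconnected_path Linf gamP (zclosed_sub IT cl1) (zclosed_sub IT cl2)
  (cov' _ IT) (disj' _).
have := Tconn _ _ (zclosed_sub TT cl1) (zclosed_sub TT cl2) (cov' _ TT) (disj' _).
case=> hT [] hI.
- by left=> A [/hT|/hI] [].
- by case: (disj (gam 0)); split; [apply: (hT _ T0).2|apply: (hI _ i0).2].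
- by case: (disj (gam 0)); split; [apply: (hI _ i0).2|apply: (hT _ T0).2].
by right=> A [/hT|/hI] [].
Qed.

End Connected.

(** * Levi decomposition and contraction *)

(** In characteristic 2 the relation [C + C^T = 0] does not force a zero diagonal, so both are
    asked. *)
Definition altmx (K : fieldType) n (C : 'M[K]_n) := (forall i, C i i = 0) /\ C + C^T = 0.

Lemma expmxZ (K : comNzRingType) n (a : K) (M : 'M[K]_n) i : (a *: M) ^+ i = a ^+ i *: M ^+ i.
Proof.
elim: i => [|i IH]; first by rewrite !expr0 scale1r.
by rewrite !exprS IH -!mulmxE -scalemxAl -scalemxAr scalerA.
Qed.

Lemma mulmx_geom (K : comNzRingType) n (M : 'M[K]_n) k : M ^+ k = 0 ->
  (1%:M - M) *m (\sum_(i < k) M ^+ i) = 1%:M.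
Proof.
move=> Mk; have := subrX1 M k; rewrite Mk sub0r => /(congr1 -%R).
by rewrite opprK -mulNr opprB -mulmxE => <-.
Qed.

Section Alt.
Variables (K : fieldType) (n : nat).
Implicit Types (A C N g : 'M[K]_n) (x y z : 'rV[K]_n).

Lemma altmxP C : altmx C <-> forall x, qmx C x = 0.
Proof.
split=> [[Cii CT] x|h]; last first.
  split=> [i|]; first by rewrite -qmx_delta h.
  apply/matrixP => i j; rewrite !mxE -bmx_delta.
  by have := qmxD C (delta_mx 0 i) (delta_mx 0 j); rewrite !h !add0r => <-.
rewrite [x]row_sum_delta; apply: (big_ind (fun x => qmx C x = 0)).
- exact: qmx0.
- by move=> u v hu hv; rewrite qmxD hu hv /bmx CT mulmx0 mul0mx mxE !addr0.
by move=> i _; rewrite qmxZ qmx_delta Cii mulr0.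
Qed.

Lemma qmx_mul m (A : 'M[K]_m) (U : 'M[K]_(n, m)) (x : 'rV[K]_n) :
  qmx (U *m A *m U^T) x = qmx A (x *m U).
Proof. by rewrite /qmx trmx_mul !mulmxA. Qed.

Lemma qmxB A C x : qmx (A - C) x = qmx A x - qmx C x.
Proof. by rewrite /qmx mulmxBr mulmxBl !mxE. Qed.

Lemma isometryP A g :
  (forall x, qmx A (x *m g) = qmx A x) <-> altmx (g *m A *m g^T - A).
Proof.
split=> [h|/altmxP h x]; first by apply/altmxP => x; rewrite qmxB qmx_mul h subrr.
by apply/eqP; rewrite -subr_eq0 -qmx_mul -qmxB h eqxx.
Qed.

Lemma isometry_gram A g : altmx (g *m A *m g^T - A) ->
  g *m (A + A^T) *m g^T = A + A^T.
Proof.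
move=> [_ /eqP]; rewrite linearB /= !trmx_mul trmxK addrACA -opprD subr_eq0 => /eqP.
by rewrite mulmxDr mulmxDl !mulmxA.
Qed.

Lemma map_altmx (L : fieldType) (f : {rmorphism K -> L}) C :
  altmx C -> altmx (map_mx f C).
Proof.
move=> [Cii CT]; split=> [i|]; first by rewrite mxE Cii rmorph0.
by rewrite map_trmx -map_mxD CT map_mx0.
Qed.

End Alt.

(* [l] spans a totally singular subspace, [Y] is a totally singular dual family:
   they give the decomposition V = W_- + W_0 + W_+ with W_- = <Y>, W_+ = <l>. *)
Section Witt.
Variables (L : fieldType) (n r : nat) (A : 'M[L]_n) (l Y : 'M[L]_(r, n)).
Local Notation B := (A + A^T).
Hypotheses (alt_l : altmx (l *m A *m l^T)) (alt_Y : altmx (Y *m A *m Y^T)).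
Hypothesis (YBl : Y *m B *m l^T = 1%:M).
Implicit Types (w : 'M[L]_r) (x : 'rV[L]_n).

Local Notation P0 := (1%:M - B *m l^T *m Y - B *m Y^T *m l).
(** The three summands of [levi 1%:M 1%:M] are the projections onto W_-, W_0 and W_+. The matrix
    [levi w w'] acts by [w] on W_-, trivially on W_0 and by [w'] on W_+. *)
Definition levi w w' : 'M[L]_n := B *m l^T *m w *m Y + P0 + B *m Y^T *m w' *m l.

Lemma trB : B^T = B.
Proof. by rewrite linearD /= trmxK addrC. Qed.

Lemma lBl : l *m B *m l^T = 0.
Proof. by case: alt_l => _; rewrite !trmx_mul trmxK mulmxDr mulmxDl !mulmxA. Qed.

Lemma YBY : Y *m B *m Y^T = 0.
Proof. by case: alt_Y => _; rewrite !trmx_mul trmxK mulmxDr mulmxDl !mulmxA. Qed.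

Lemma lBY : l *m B *m Y^T = 1%:M.
Proof. by rewrite -trB -[l]trmxK -mulmxA -!trmx_mul YBl trmx1. Qed.

Lemma levi_l w w' : l *m levi w w' = w' *m l.
Proof.
by rewrite /levi !mulmxDr !mulmxN mulmx1 !mulmxA lBl lBY !mul0mx !mul1mx subr0 subrr !add0r.
Qed.

Lemma levi_Y w w' : Y *m levi w w' = w *m Y.
Proof.
by rewrite /levi !mulmxDr !mulmxN mulmx1 !mulmxA YBl YBY !mul0mx !mul1mx subrr subr0 !addr0.
Qed.

Lemma levi_P0 w w' : P0 *m levi w w' = P0.
Proof.
rewrite !mulmxBl mul1mx -!(mulmxA _ _ (levi _ _)) levi_l levi_Y /levi !mulmxA.
have E (a p c : 'M[L]_n) : a + p + c - a - c = p.
  by rewrite -[LHS]addrA -opprD [a + p + c]addrAC addrAC subrr add0r.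
exact: E.
Qed.

Lemma levi1 : levi 1%:M 1%:M = 1%:M.
Proof.
have E (a p c : 'M[L]_n) : a + (p - a - c) + c = p by rewrite -addrA subrK addrC subrK.
by rewrite /levi !mulmx1 E.
Qed.

Lemma leviM w1 w1' w2 w2' : levi w1 w1' *m levi w2 w2' = levi (w1 *m w2) (w1' *m w2').
Proof.
rewrite {1}/levi mulmxDl [(_ + P0) *m _]mulmxDl levi_P0.
by rewrite -(mulmxA _ l) -(mulmxA _ Y) levi_l levi_Y /levi !mulmxA.
Qed.

(** W_- and W_+ are singular, dual to each other and orthogonal to W_0, so q(c Y + p + d l) = q(p) +
    c d^T; replacing c, d by c w, d w' preserves this value. *)
Lemma levi_isometry w w' : w *m w'^T = 1%:M -> O_Q (qmx A) (levi w w').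
Proof.
move=> ww'.
have w'w : w' *m w^T = 1%:M by rewrite -[w']trmxK -trmx_mul ww' trmx1.
split.
  have /mulmx1_unit[] // : levi w w' *m levi (w'^T) (w^T) = 1%:M.
  by rewrite leviM ww' w'w levi1.
move=> x; set a := x *m B *m l^T; set b := x *m B *m Y^T; set p := x *m P0.
have QY c : qmx A (c *m Y) = 0 by rewrite -qmx_mul ((altmxP _).1 alt_Y).
have Ql c : qmx A (c *m l) = 0 by rewrite -qmx_mul ((altmxP _).1 alt_l).
have pB m (U : 'M[L]_(m, n)) d : P0 *m B *m U^T = 0 -> bmx A p (d *m U) = 0.
  by move=> h; rewrite /bmx trmx_mul !mulmxA -(mulmxA x) -(mulmxA x) h mulmx0 mul0mx mxE.
have pl d : bmx A p (d *m l) = 0.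
  by apply: pB; rewrite !mulmxBl mul1mx -!mulmxA (mulmxA Y) YBl (mulmxA l) lBl !mulmx0 mulmx1 subrr subr0.
have pY d : bmx A p (d *m Y) = 0.
  by apply: pB; rewrite !mulmxBl mul1mx -!mulmxA (mulmxA Y) YBY (mulmxA l) lBY !mulmx0 mulmx1 subr0 subrr.
have Qs c d : qmx A (c *m Y + p + d *m l) = qmx A p + (c *m d^T) 0 0.
  rewrite !qmxD QY Ql bmxDl pl [bmx A _ p]bmxC pY /bmx trmx_mul mulmxA.
  by rewrite -(mulmxA c) -(mulmxA c) YBl mulmx1; ring.
have xE v v' : x *m levi v v' = a *m v *m Y + p + b *m v' *m l.
  by rewrite /levi mulmxDr [x *m (_ + P0)]mulmxDr !mulmxA.
have -> : x *m levi w w' = a *m w *m Y + p + b *m w' *m l.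
  by rewrite xE.
have -> : x = a *m 1%:M *m Y + p + b *m 1%:M *m l.
  by rewrite -xE levi1 mulmx1.
by rewrite !Qs !mulmx1 trmx_mul mulmxA -(mulmxA a) ww' mulmx1.
Qed.

Variable (N : 'M[L]_n).
Local Notation g := (1%:M + N).
Hypothesis (alt_g : altmx (g *m A *m g^T - A)).
Hypothesis (linf : infinite_field L).
Variables (W0 : 'M[L]_r) (W : 'M[L]_(n, r)) (k : nat).
(** [1%:M - B *m l^T *m Y] projects onto the orthogonal of [l], so [PN] says that [N] maps this
    orthogonal into the span of [l]. *)
Hypotheses (lN : l *m N = W0 *m l) (PN : (1%:M - B *m l^T *m Y) *m N = W *m l).
Hypothesis (N_nil : N ^+ k = 0).

(** The action induced by [N] on the quotient of V by the orthogonal of [l], in the basis given by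
    [Y]. *)
Let nu := Y *m N *m B *m l^T.

Lemma N_Bl : N *m B *m l^T = B *m l^T *m nu.
Proof.
have -> : N = B *m l^T *m Y *m N + W *m l by rewrite -PN mulmxBl mul1mx addrC subrK.
by rewrite !mulmxDl -!mulmxA (mulmxA l) lBl !mulmx0 addr0 /nu !mulmxA.
Qed.

Lemma nuX j : nu ^+ j = Y *m N ^+ j *m B *m l^T.
Proof.
elim: j => [|j IH]; first by rewrite !expr0 mulmx1 YBl.
rewrite exprSr IH -mulmxE exprSr -mulmxE -!mulmxA; congr (_ *m _).
by rewrite [N *m (_ *m _)]mulmxA N_Bl !mulmxA.
Qed.

(** Since [g] preserves the polar form, its actions on V / l^perp and on the span of [l] are
    contragredient. *)
Lemma levi_nu : (1%:M + nu) *m (1%:M + W0)^T = 1%:M.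
Proof.
have -> : 1%:M + nu = Y *m g *m B *m l^T by rewrite mulmxDr mulmx1 !mulmxDl YBl.
rewrite -(mulmxA _ l^T) -trmx_mul mulmxDl mul1mx -lN.
have -> : l + l *m N = l *m g by rewrite mulmxDr mulmx1.
rewrite trmx_mul -mulmxA (mulmxA B) !mulmxA -(mulmxA Y) -(mulmxA Y).
by rewrite (isometry_gram alt_g).
Qed.

Lemma in_identity_component_levi : in_identity_component (O_Q (qmx A)) (levi (1%:M + nu) (1%:M + W0)).
Proof.
(* The transposed inverse of [1%:M + t *: nu], polynomial in [t] because [nu] is nilpotent. With
   [k.+2] terms the indices 0 and 1 always occur, as needed to write the whole path with one range
   of exponents. *)
pose S (t : L) := \sum_(i < k.+2) (- t) ^+ i *: (nu ^+ i)^T.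
have nuk : nu ^+ k.+2 = 0 by rewrite nuX -addn2 exprD N_nil mul0r mulmx0 !mul0mx.
have inv t : (1%:M + t *: nu) *m (S t)^T = 1%:M.
  have -> : (S t)^T = \sum_(i < k.+2) (- t *: nu) ^+ i.
    by rewrite linear_sum; apply: eq_bigr => i _; rewrite linearZ /= trmxK expmxZ.
  have z : (- t *: nu) ^+ k.+2 = 0 by rewrite expmxZ nuk scaler0.
  by have := mulmx_geom z; rewrite {1}scaleNr opprK.
pose gam t := levi (1%:M + t *: nu) (S t).
have <- : gam 1 = levi (1%:M + nu) (1%:M + W0).
  rewrite /gam scale1r; congr levi; apply: trmx_inj.
  have h1 := inv 1; rewrite scale1r in h1.
  have h2 := mulmx1C levi_nu.
  have : (1%:M + W0)^T *m ((1%:M + nu) *m (S 1)^T) = (S 1)^T by rewrite mulmxA h2 mul1mx.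
  by rewrite h1 mulmx1.
apply: in_identity_component_path => //.
- pose c i := if i is j.+1 then (if j is _.+1 then 0 else nu) else 1%:M : 'M[L]_r.
  exists k.+2, (fun i => B *m l^T *m c i *m Y + (if i == 0%N then P0 else 0)
     + B *m Y^T *m ((-1) ^+ i *: (nu ^+ i)^T) *m l) => t.
  rewrite /gam /levi.
  under eq_bigr do rewrite !scalerDr; rewrite !big_split /=; congr (_ + _ + _).
  + rewrite !big_ord_recl big1 => [|i _]; last by rewrite /= mulmx0 mul0mx scaler0.
    by rewrite addr0 /= expr0 expr1 scale1r !mulmxDr mulmxDl -scalemxAr -scalemxAl.
  + by rewrite big_ord_recl big1 => [|i _]; rewrite /= ?scaler0 // addr0 expr0 scale1r.
  rewrite mulmx_sumr mulmx_suml; apply: eq_bigr => i _.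
  by rewrite -!scalemxAr -!scalemxAl !scalerA [(- t) ^+ i]exprNn mulrC.
- by move=> t; apply: levi_isometry; apply: inv.
suff -> : gam 0 = 1%:M.
  by apply: in_identity_component1; rewrite -levi1; apply: levi_isometry; rewrite trmx1 mulmx1.
rewrite /gam scale0r addr0 (_ : S 0 = 1%:M) ?levi1 // /S big_ord_recl big1 => [|i _].
  by rewrite expr0 scale1r expr0 trmx1 addr0.
by rewrite /= oppr0 expr0n scale0r.
Qed.

(* Conjugating by the one-parameter group acting by t on W_-, 1 on W_0 and
   t^-1 on W_+ contracts [g] to its Levi part as t tends to 0. *)
Lemma in_identity_component_parabolic : in_identity_component (O_Q (qmx A)) g.
Proof.
pose pm := B *m l^T *m Y; pose pp := B *m Y^T *m l; pose p0 := 1%:M - pm - pp.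
(* The conjugate of [g] written blockwise: each block of [N] is multiplied by [t] to its weight, and
   the value at 0 is the Levi part. *)
pose gam t := levi (1%:M + nu) (1%:M + W0) + t *: (pm *m N *m p0 + p0 *m N *m pp)
              + t ^+ 2 *: (pm *m N *m pp).
have leviE a b : levi (a%:M) (b%:M) = a *: pm + p0 + b *: pp.
  by rewrite /levi !mul_mx_scalar -!scalemxAl.
have lpm : l *m pm = 0 by rewrite /pm !mulmxA lBl mul0mx.
have lpp : l *m pp = l by rewrite /pp !mulmxA lBY mul1mx.
have lp0 : l *m p0 = 0 by rewrite /p0 !mulmxBr mulmx1 lpm lpp subr0 subrr.
have ppN : pp *m N = B *m Y^T *m W0 *m l by rewrite /pp -mulmxA lN !mulmxA.
have p0N : p0 *m N = (W - B *m Y^T *m W0) *m l by rewrite /p0 mulmxBl PN ppN -mulmxBl.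
have gam0E : gam 0 = levi (1%:M + nu) (1%:M + W0).
  by rewrite /gam scale0r addr0 expr0n scale0r addr0.
have leviE' : levi (1%:M + nu) (1%:M + W0) = 1%:M + pm *m N *m pm + pp *m N *m pp.
  have E (a b c u v : 'M[L]_n) : a + u + (c - a - b) + (b + v) = c + u + v.
    by apply/matrixP => i j; rewrite !mxE; ring.
  have epm : pm *m N *m pm = B *m l^T *m nu *m Y by rewrite /pm /nu !mulmxA.
  have epp : pp *m N *m pp = B *m Y^T *m W0 *m l by rewrite ppN -(mulmxA _ l) lpp.
  rewrite epm epp -[RHS](E pm pp); congr (_ + _ + _).
    by rewrite mulmxDr mulmx1 mulmxDl.
  by rewrite mulmxDr mulmx1 mulmxDl.
(* The blocks of negative weight vanish because [N] preserves the span of [l] and sends l^perp into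
   it; the latter also kills the block of W_0. *)
have z1 : pp *m N *m pm = 0 by rewrite ppN -(mulmxA _ l) lpm mulmx0.
have z2 : pp *m N *m p0 = 0 by rewrite ppN -(mulmxA _ l) lp0 mulmx0.
have z3 : p0 *m N *m pm = 0 by rewrite p0N -(mulmxA _ l) lpm mulmx0.
have z4 : p0 *m N *m p0 = 0 by rewrite p0N -(mulmxA _ l) lp0 mulmx0.
have gamE t : t != 0 -> gam t = levi (t%:M) (t^-1%:M) *m g *m levi (t^-1%:M) (t%:M).
  move=> tn0; rewrite mulmxDr mulmx1 mulmxDl leviM -!scalar_mxM mulfV // mulVf // levi1.
  rewrite /gam leviE' !leviE; move: pm pp p0 z1 z2 z3 z4 {tn0 lpm lpp lp0 ppN p0N gam gam0E leviE leviE'} (mulfV tn0) (mulVf tn0).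
  move=> pm' pp' p0' z1 z2 z3 z4 tV Vt.
  rewrite !mulmxDl !mulmxDr -!scalemxAl -!scalemxAr z1 z2 z3 z4 !scalerA tV Vt !scaler0 !scale1r.
  move: (pm' *m N *m pm') (pp' *m N *m pp') (pm' *m N *m p0') (p0' *m N *m pp') (pm' *m N *m pp') => M1 M2 M3 M4 M5.
  by clear; apply/matrixP => i j; rewrite !mxE; ring.
have gO : O_Q (qmx A) g.
  split; last exact/isometryP.
  have nk : (- N) ^+ k = 0 by rewrite exprNn N_nil mulr0.
  by have := mulmx_geom nk; rewrite opprK => /mulmx1_unit[].
have OM (g1 g2 : 'M[L]_n) : O_Q (qmx A) g1 -> O_Q (qmx A) g2 -> O_Q (qmx A) (g1 *m g2).
  by move=> [u1 q1] [u2 q2]; split; [rewrite unitmx_mul u1|move=> x; rewrite mulmxA q2].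
have <- : gam 1 = g.
  by rewrite gamE ?oner_eq0 // invr1 levi1 mul1mx mulmx1.
apply: in_identity_component_path => //.
- exists 3, (fun i => nth 0 [:: levi (1%:M + nu) (1%:M + W0);
      pm *m N *m p0 + p0 *m N *m pp; pm *m N *m pp] i) => t.
  by rewrite !big_ord_recl big_ord0 addr0 /= expr0 scale1r addrA.
- move=> t; have [->|tn0] := eqVneq t 0; first by rewrite gam0E; apply: levi_isometry levi_nu.
  rewrite gamE //; apply: (OM _ _); [apply: (OM _ _) => //|]; apply: levi_isometry;
  by rewrite tr_scalar_mx -scalar_mxM ?mulfV ?mulVf.
by rewrite gam0E; apply: in_identity_component_levi.
Qed.

End Witt.

(** * Elements of parabolic subgroups *)

Lemma map_mxX (K L : fieldType) (f : {rmorphism K -> L}) n (N : 'M[K]_n) k :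
  map_mx f (N ^+ k) = map_mx f N ^+ k.
Proof.
elim: k => [|k IH]; first by rewrite !expr0 map_mx1.
by rewrite !exprS -!mulmxE map_mxM IH.
Qed.

(** On the radical q is additive, so injectivity there amounts to having no nonzero zero. *)
Definition anisotropic_rad (K : fieldType) n (A : 'M[K]_n) :=
  forall x, (x <= radmx A)%MS -> qmx A x = 0 -> x = 0.

Section Parabolic.
Variables (K : fieldType) (n : nat) (A g U : 'M[K]_n) (k : nat).
Local Notation B := (A + A^T).
Hypothesis rad_aniso : anisotropic_rad A.
Hypotheses (g_isom : forall x, qmx A (x *m g) = qmx A x) (g_nil : (g - 1%:M) ^+ k = 0).
Hypotheses (U_sing : forall x, (x <= U)%MS -> qmx A x = 0) (U_stab : (U *m g <= U)%MS)
  (U_perp : (perp A U *m (g - 1%:M) <= U)%MS).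

(** A totally singular subspace meets the anisotropic radical trivially, so [l] has a dual family
    [Y0], which is then corrected by a combination of [l]. *)
Lemma dual_singular_family r (l : 'M[K]_(r, n)) : row_free l -> (l <= U)%MS ->
  exists Y : 'M[K]_(r, n), altmx (Y *m A *m Y^T) /\ Y *m B *m l^T = 1%:M.
Proof.
move=> free_l lU.
have : row_full (B *m l^T).
  rewrite /row_full -mxrank_tr trmx_mul trmxK trB.
  have := mxrank_mul_ker l B; rewrite (_ : (l :&: kermx B)%MS = 0) ?mxrank0 ?addn0.
    by move=> ->.
  apply/eqP; rewrite -submx0; apply/rV_subP => x; rewrite sub_capmx => /andP[xl xR].
  by rewrite submx0 (rad_aniso xR) ?U_sing // (submx_trans xl lU).
move=> /row_fullP[Y0 Y0Bl].
have alt_l : altmx (l *m A *m l^T).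
  by apply/altmxP => x; rewrite qmx_mul U_sing // (submx_trans (submxMl _ _) lU).
(* Subtracting [D *m l] changes q(x Y0) by -b(x Y0, x D l), which is exactly -q(x Y0); no division
   by 2 occurs. *)
rewrite mulmxA in Y0Bl; pose D := Y0 *m A *m Y0^T.
exists (Y0 - D *m l); split; last first.
  by rewrite mulmxBl mulmxBl Y0Bl -!mulmxA (mulmxA l) lBl // !mulmx0 subr0.
apply/altmxP => x; rewrite qmx_mul mulmxBr qmxD qmxN mulmxA -(qmx_mul A l) ((altmxP _).1 alt_l).
rewrite addr0 bmxNr -qmx_mul -/D /bmx [(x *m D *m l)^T]trmx_mul [(x *m D)^T]trmx_mul !mulmxA.
by rewrite -(mulmxA x) -(mulmxA x) Y0Bl mulmx1 /qmx mx11_tr subrr.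
Qed.

Lemma parabolic_data : exists r (l Y W0' : 'M[K]_(r, n)) (W0 : 'M[K]_r) (W : 'M[K]_(n, r)),
  [/\ altmx (l *m A *m l^T), altmx (Y *m A *m Y^T), Y *m B *m l^T = 1%:M,
      l *m (g - 1%:M) = W0 *m l & (1%:M - B *m l^T *m Y) *m (g - 1%:M) = W *m l].
Proof.
have lU := eq_row_base U; set l := row_base U in lU.
have sub_lU : (l <= U)%MS by rewrite lU.
have [Y [alt_Y YBl]] := dual_singular_family (row_base_free U) sub_lU.
have /submxP[W0 W0E] : (l *m (g - 1%:M) <= l)%MS.
  rewrite mulmxBr mulmx1 addmx_sub ?eqmx_opp // lU.
  by rewrite (submx_trans _ U_stab) // submxMr.
have /submxP[W WE] : ((1%:M - B *m l^T *m Y) *m (g - 1%:M) <= l)%MS.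
  rewrite lU (submx_trans _ U_perp) // submxMr //.
  apply: submx_trans (perpS A (_ : (U <= l)%MS)); last by rewrite lU.
  by apply/sub_kermxP; rewrite mulmxBl mul1mx -!mulmxA (mulmxA Y) YBl mulmx1 subrr.
exists (\rank U), l, Y, l, W0, W; split => //.
by apply/altmxP => x; rewrite qmx_mul U_sing // -lU submxMl.
Qed.

(** The parabolic data are matrix identities and survive base change along [f], so the same
    contraction works over [K] when it is closed and over an algebraic closure when it is finite. *)
Lemma SO_parabolic : qform_mx (qmx A) = A -> SO_Q (qmx A) g.
Proof.
move=> AE; have [r [l [Y [_ [W0 [W [alt_l alt_Y YBl lN PN]]]]]]] := parabolic_data.
have gE : g = 1%:M + (g - 1%:M) by rewrite addrC subrK.
have alt_g := (isometryP A g).1 g_isom.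
split=> [Kcl|_].
  rewrite gE; apply: (in_identity_component_parabolic alt_l alt_Y YBl _ _ lN PN g_nil).
    by rewrite -gE.
  exact: alg_closed_infinite.
split=> [|L f _].
  split=> //; have nk : (1%:M - g) ^+ k = 0.
    by rewrite -opprB exprNn g_nil mulr0.
  by have := mulmx_geom nk; rewrite subKr => /mulmx1_unit[].
rewrite Qext_qmx AE.
have mapB : map_mx f A + (map_mx f A)^T = map_mx f B by rewrite map_mxD map_trmx.
have -> : map_mx f g = 1%:M + map_mx f (g - 1%:M).
  by rewrite -(map_mx1 f) -map_mxD -gE.
have alt_l' := map_altmx f alt_l; have alt_Y' := map_altmx f alt_Y.
have alt_g' := map_altmx f alt_g.
rewrite !map_mxM ?map_mxB ?map_mxM -!map_trmx in alt_l' alt_Y' alt_g'.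
have YBl' : map_mx f Y *m (map_mx f A + (map_mx f A)^T) *m (map_mx f l)^T = 1%:M.
  by rewrite mapB map_trmx -!map_mxM YBl map_mx1.
have lN' : map_mx f l *m map_mx f (g - 1%:M) = map_mx f W0 *m map_mx f l.
  by rewrite -!map_mxM lN.
have PN' : (1%:M - (map_mx f A + (map_mx f A)^T) *m (map_mx f l)^T *m map_mx f Y)
    *m map_mx f (g - 1%:M) = map_mx f W *m map_mx f l.
  by rewrite mapB map_trmx -(map_mx1 f) -!map_mxM -map_mxB -map_mxM PN.
have N_nil' : map_mx f (g - 1%:M) ^+ k = 0 by rewrite -map_mxX g_nil map_mx0.
apply: (in_identity_component_parabolic alt_l' alt_Y' YBl' _ _ lN' PN' N_nil').
  by rewrite -(map_mx1 f) -map_mxD -gE.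
by apply: alg_closed_infinite; apply: solve_monicpoly.
Qed.

End Parabolic.

Lemma unipotent_nilpotent (K : fieldType) n (g : 'M[K]_n) : (0 < n)%N ->
  unipotent g -> (g - 1%:M) ^+ n = 0.
Proof.
case: n g => // n g _ gU; have := Cayley_Hamilton g.
rewrite gU rmorphXn rmorphB /= horner_mx_X rmorph1 => <-.
by congr (_ ^+ _).
Qed.

(** Put c = X - 1. As c - N divides c^k - N^k = c^k, determinants show that the characteristic
    polynomial divides (X - 1)^(kn); its degree then fixes it. *)
Lemma nilpotent_unipotent (K : fieldType) n (N : 'M[K]_n) k :
  N ^+ k = 0 -> unipotent (1%:M + N).
Proof.
move=> Nk; rewrite /unipotent.
have cE : char_poly (1%:M + N) = \det (('X - 1)%:M - map_mx polyC N).
  by rewrite /char_poly /char_poly_mx map_mxD map_scalar_mx [(_ - _)%:M]raddfB /= opprD addrA.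
have : (char_poly (1%:M + N) %| ('X - 1%:P) ^+ (k * n))%R.
  set M := map_mx polyC N in cE; pose c : 'M[{poly K}]_n := ('X - 1)%:M.
  have com : GRing.comm c M by rewrite /GRing.comm -mulmxE scalar_mxC.
  have Mk : M ^+ k = 0.
    rewrite -(map_mx0 polyC) -Nk /M; elim: (k) => [|j IH]; first by rewrite !expr0 map_mx1.
    by rewrite !exprS -!mulmxE map_mxM IH.
  have ck : c ^+ k = (('X - 1) ^+ k)%:M.
    elim: (k) => [|j IH]; first by rewrite !expr0.
    by rewrite !exprS -mulmxE IH scalar_mxM.
  have := subrXX_comm k com; rewrite Mk subr0 ck -mulmxE => /(congr1 determinant).
  by rewrite det_scalar det_mulmx -exprM cE => ->; rewrite dvdp_mulr.
case/dvdp_exp_XsubCP => m _; rewrite eqp_monic ?char_poly_monic ?monic_exp ?monicXsubC //.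
move=> /eqP cm; have := size_char_poly (1%:M + N).
by rewrite cm size_exp_XsubC => -[->].
Qed.

(** * The Dickson invariant *)

Section SecondCoefficient.
Variables (R : comNzRingType) (n : nat).
Implicit Types (a b : 'M[R]_n).

(* The coefficient of X^(n-2) in the characteristic polynomial of [a]. *)
Definition s2mx a : R := \sum_(i < n) \sum_(j < n | (i < j)%N) (a i i * a j j - a i j * a j i).

Lemma sum_ltn_sym (F : 'I_n -> 'I_n -> R) : (forall i, F i i = 0) ->
  \sum_(i < n) \sum_(j < n | (i < j)%N) (F i j + F j i) = \sum_(i < n) \sum_(j < n) F i j.
Proof.
move=> F0; under eq_bigr do rewrite big_split.
rewrite big_split /= [X in _ + X](exchange_big_dep xpredT) //= -big_split.
apply: eq_bigr => i _ /=; rewrite [RHS](bigID (fun j : 'I_n => (i < j)%N)) /=; congr (_ + _).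
rewrite [RHS](bigD1 i) ?ltnn //= F0 add0r.
by apply: eq_bigl => j; rewrite -leqNgt ltn_neqAle andbC.
Qed.

Lemma s2mxD a b : s2mx (a + b) = s2mx a + s2mx b + \tr a * \tr b - \tr (a *m b).
Proof.
have -> : s2mx (a + b) = s2mx a + s2mx b
    + \sum_(i < n) \sum_(j < n | (i < j)%N)
        ((a i i * b j j - a i j * b j i) + (a j j * b i i - a j i * b i j)).
  rewrite /s2mx -!big_split; apply: eq_bigr => i _.
  by rewrite -!big_split; apply: eq_bigr => j _; rewrite !mxE /=; ring.
rewrite (sum_ltn_sym (F := fun i j => a i i * b j j - a i j * b j i)) => [|i]; last by ring.
rewrite -[RHS]addrA; congr (_ + _); rewrite /mxtrace big_distrl /= -sumrB; apply: eq_bigr => i _.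
by rewrite mxE big_distrr /= -sumrB.
Qed.

(** Cauchy-Binet for 2 by 2 minors: both sides are the same double sum of products of a minor of [a]
    and a minor of [b]. *)
Lemma s2mx_mulC a b : s2mx (a *m b) = s2mx (b *m a).
Proof.
have E c d : s2mx (c *m d) = \sum_(i < n) \sum_(j < n | (i < j)%N)
     \sum_(k < n) \sum_(l < n | (k < l)%N)
       (c i k * c j l - c i l * c j k) * (d k i * d l j - d k j * d l i).
  apply: eq_bigr => i _; apply: eq_bigr => j _.
  pose G k l := c i k * c j l * (d k i * d l j - d k j * d l i).
  transitivity (\sum_k \sum_l G k l).
    rewrite !mxE !big_distrl /= -sumrB; apply: eq_bigr => k _.
    by rewrite !big_distrr /= -sumrB; apply: eq_bigr => l _; rewrite /G; ring.
  rewrite -sum_ltn_sym => [|k]; last by rewrite /G; ring.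
  by apply: eq_bigr => k _; apply: eq_bigr => l _; rewrite /G; ring.
rewrite !E [LHS]pair_big_dep [RHS]pair_big_dep /=.
under eq_bigr do rewrite pair_big_dep /=.
under [RHS]eq_bigr do rewrite pair_big_dep /=.
rewrite exchange_big /=; apply: eq_bigr => p _; apply: eq_bigr => r _; ring.
Qed.

End SecondCoefficient.

Section Dickson.
Variables (K : fieldType) (n : nat) (A : 'M[K]_n).
Local Notation B := (A + A^T).
Local Notation P := (invmx (A + A^T)).
Hypotheses (char2 : 2%:R = 0 :> K) (B_unit : B \in unitmx).
Implicit Types (g W D : 'M[K]_n).

Definition upmx m (C : 'M[K]_m) : 'M[K]_m := \matrix_(i, j) if (i < j)%N then C i j else 0.

(* [g A g^T - A] represents q o g - q = 0, so it is alternating: it is paired here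
   with the alternating matrix [P], each pair {i, j} being counted once. *)
Definition dickson g : K := \tr (P *m upmx (g *m A *m g^T - A)).

Lemma addmm m p (M : 'M[K]_(m, p)) : M + M = 0.
Proof. by rewrite -mulr2n -scaler_nat char2 scale0r. Qed.

Lemma oppm m p (M : 'M[K]_(m, p)) : - M = M.
Proof. by apply/eqP; rewrite eq_sym -addr_eq0 addmm. Qed.

Lemma oppc (c : K) : - c = c.
Proof. by apply/eqP; rewrite eq_sym -addr_eq0 -mulr2n -mulr_natr char2 mulr0. Qed.

Lemma upmxE m (C : 'M[K]_m) : altmx C -> upmx C + (upmx C)^T = C.
Proof.
move=> [C0 CT]; apply/matrixP => i j; rewrite !mxE.
have Cji : C j i = C i j.
  by move/matrixP/(_ i j): CT; rewrite !mxE => /eqP; rewrite addr_eq0 oppc => /eqP ->.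
case: (ltngtP i j) => [||/val_inj ->]; rewrite ?addr0 ?add0r ?Cji ?C0 //.
Qed.

Lemma trP : P^T = P.
Proof. by rewrite trmx_inv trB. Qed.

(** [P] is the sum of P A P and its transpose; both pair equally with a symmetric matrix, so the
    trace is a double. *)
Lemma tr_P_sym D : D^T = D -> \tr (P *m D) = 0.
Proof.
move=> DT; have PE : P = P *m A *m P + P *m A^T *m P.
  by rewrite -mulmxDl -mulmxDr mulVmx // mul1mx.
rewrite PE mulmxDl linearD /= -[X in _ + \tr X]trmxK [X in _ + X]mxtrace_tr.
rewrite !trmx_mul trmxK trP DT mxtrace_mulC !mulmxA.
by rewrite -mulr2n -mulr_natl char2 mul0r.
Qed.

(** Two matrices [W] with the same [W + W^T] differ by a symmetric one, which [tr_P_sym] kills. *)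
Lemma dicksonE g W : altmx (g *m A *m g^T - A) -> W + W^T = g *m A *m g^T - A ->
  dickson g = \tr (P *m W).
Proof.
move=> /upmxE; rewrite /dickson; set W' := upmx _ => <- WW.
apply/eqP; rewrite -subr_eq0 -linearB /= -mulmxBr tr_P_sym //.
rewrite linearB /= !oppm; apply/eqP; rewrite -subr_eq0 oppm addrACA [W'^T + _]addrC.
by rewrite [W^T + W]addrC WW addmm.
Qed.

Lemma gram_inv g : altmx (g *m A *m g^T - A) -> g^T *m P *m g = P.
Proof.
move=> alt_g; have gB := isometry_gram alt_g.
have h : B *m (g^T *m P *m g) = 1%:M.
  have : g *m (B *m g^T *m P) = 1%:M by rewrite !mulmxA gB mulmxV.
  by move/mulmx1C; rewrite !mulmxA.
by rewrite -[RHS]mulmx1 -h mulKmx.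
Qed.

(** The defect of [g *m h] is the defect of [g] plus the conjugate by [g] of that of [h], and g^T P
    g = P removes the conjugation from the trace. *)
Lemma dicksonM g h : altmx (g *m A *m g^T - A) -> altmx (h *m A *m h^T - A) ->
  dickson (g *m h) = dickson g + dickson h.
Proof.
move=> alt_g alt_h; have gP := gram_inv alt_g.
rewrite (@dicksonE _ (g *m upmx (h *m A *m h^T - A) *m g^T + upmx (g *m A *m g^T - A))).
- rewrite mulmxDr linearD /= addrC; congr (_ + _).
  by rewrite !mulmxA mxtrace_mulC !mulmxA gP.
- apply/isometryP => x; rewrite mulmxA.
  by rewrite ((isometryP _ _).2 alt_h) ((isometryP _ _).2 alt_g).
have conj u : g *m u *m g^T + (g *m u *m g^T)^T = g *m (u + u^T) *m g^T.
  by rewrite !trmx_mul trmxK mulmxDr mulmxDl !mulmxA.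
rewrite [(_ + _)^T]linearD /= addrACA conj (upmxE alt_g) (upmxE alt_h) trmx_mul.
by rewrite mulmxBr mulmxBl !mulmxA addrA subrK.
Qed.

Lemma dickson1 : dickson 1%:M = 0.
Proof.
have a1 : altmx (1%:M *m A *m 1%:M^T - A).
  by apply/isometryP => x; rewrite mulmx1.
by have /eqP := dicksonM a1 a1; rewrite mulmx1 -subr_eq subrr eq_sym => /eqP.
Qed.

Definition reflmx (v : 'rV[K]_n) : 'M[K]_n := 1%:M - (qmx A v)^-1 *: (B *m v^T *m v).

Lemma reflmxE v x : x *m reflmx v = x - (bmx A x v / qmx A v) *: v.
Proof.
rewrite mulmxBr mulmx1 -scalemxAr !mulmxA; congr (_ - _).
by rewrite [x *m _ *m _]mx11_scalar mul_scalar_mx scalerA mulrC.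
Qed.

Lemma reflmx_isometry v : qmx A v != 0 -> forall x, qmx A (x *m reflmx v) = qmx A x.
Proof.
move=> qv x; rewrite reflmxE qmxD qmxN qmxZ bmxNr bmxZr.
by field.
Qed.

Lemma dickson_refl v : qmx A v != 0 -> dickson (reflmx v) = 1.
Proof.
(* This [W] is q(v)^-1 A u^T with u = B v^T v. In the expansion of the defect the term quadratic in
   u is q(v)^-1 u B, and u A + u B = u A^T supplies [W^T]. The trace of P W is q(v)^-1 v A v^T. *)
move=> qv; rewrite (@dicksonE _ ((qmx A v)^-1 *: (A *m v^T *m v *m B))).
- rewrite -scalemxAr linearZ /= !mulmxA mxtrace_mulC !mulmxA mulmxV // mul1mx.
  by rewrite mxtrace_mulC mulmxA [_ *m v^T]mx11_scalar mxtrace_scalar mulr1n mulVf.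
- exact/isometryP/reflmx_isometry.
pose u := B *m v^T *m v; have uT : u^T = v^T *m v *m B.
  by rewrite !trmx_mul trmxK trB mulmxA.
have uAu : u *m A *m u^T = qmx A v *: (u *m B).
  rewrite uT /u !mulmxA -(mulmxA _ v A) -(mulmxA _ (v *m A)).
  by rewrite [v *m A *m v^T]mx11_scalar mul_mx_scalar -!scalemxAl.
have uB : u *m A + u *m B = u *m A^T by rewrite -mulmxDr addrA addmm add0r.
have -> : A *m v^T *m v *m B = A *m u^T by rewrite uT !mulmxA.
rewrite [(_ *: _)^T]linearZ /= [(A *m u^T)^T]trmx_mul trmxK -uB.
rewrite /reflmx -/u [(_ - _)^T]linearB /= trmx1 [(_ *: _)^T]linearZ /= !oppm.
have E c (M U V T : 'M[K]_n) : c != 0 -> U *m M *m V = c *: (U *m T) ->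
    (1%:M + c^-1 *: U) *m M *m (1%:M + c^-1 *: V) + M = c^-1 *: (M *m V + (U *m M + U *m T)).
  move=> c0 UMV; rewrite mulmxDl mulmxDr !mulmxDl mul1mx !mulmx1 -!scalemxAl -!scalemxAr UMV.
  rewrite !scalerDr !scalerA -mulrA mulVf // mulr1.
  move: (c^-1 *: _) (c^-1 *: _) (c^-1 *: _) => X Y Z.
  by rewrite addrAC [M + _ + M]addrAC addmm add0r addrCA addrA.
by rewrite (E _ _ _ _ B) // -scalerDr.
Qed.

(* [P g A g^T] is conjugate to [P A], so both have the same [s2mx]; expanding
   with [s2mxD], using [P A + P A^T = 1], leaves d^2 - d = 0. *)
Lemma dickson_idem g : altmx (g *m A *m g^T - A) -> dickson g ^+ 2 = dickson g.
Proof.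
move=> alt_g; set W := upmx (g *m A *m g^T - A); set d := dickson g.
have WW : W + W^T = g *m A *m g^T - A by apply: upmxE.
have s2_eq : s2mx (P *m A + (P *m W + P *m W^T)) = s2mx (P *m A).
  rewrite -mulmxDr WW -mulmxDr [A + (_ - _)]addrC subrK.
  rewrite (_ : P *m (g *m A *m g^T) = P *m g *m (A *m g^T)); last by rewrite !mulmxA.
  have gTu : g^T \in unitmx.
    have : g *m (B *m g^T *m P) = 1%:M by rewrite !mulmxA (isometry_gram alt_g) mulmxV.
    by case/mulmx1_unit; rewrite unitmx_tr.
  have Pg : P *m g = invmx g^T *m P by rewrite -{2}(gram_inv alt_g) -mulmxA mulKmx.
  by rewrite Pg -mulmxA s2mx_mulC -!mulmxA mulmxV // mulmx1.
have trT : \tr (P *m W^T) = d.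
  by rewrite -mxtrace_tr trmx_mul trmxK trP mxtrace_mulC.
have tr0 : \tr (P *m W *m (P *m W^T)) = 0.
  rewrite -!mulmxA tr_P_sym // !trmx_mul trmxK trP !mulmxA //.
have trl : \tr (P *m A *m (P *m W + P *m W^T)) = d.
  have eq2 : \tr (P *m A *m (P *m W^T)) = \tr (P *m A^T *m P *m W).
    by rewrite -mxtrace_tr !trmx_mul trmxK trP -!mulmxA mxtrace_mulC !mulmxA.
  rewrite mulmxDr linearD /= eq2 mulmxA -linearD /= -mulmxDl -mulmxDl -mulmxDr.
  by rewrite mulVmx // mul1mx.
have := s2mxD (P *m A) (P *m W + P *m W^T).
rewrite s2_eq trl linearD /= trT -/d -mulr2n -[d *+ 2]mulr_natl char2 mul0r mulr0 addr0.
have -> : s2mx (P *m W + P *m W^T) = d ^+ 2.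
  have s2T : s2mx (P *m W^T) = s2mx (P *m W).
    have tr_s2 (M : 'M[K]_n) : s2mx M^T = s2mx M.
      by apply: eq_bigr => i _; apply: eq_bigr => j _; rewrite !mxE [M j i * _]mulrC.
    by rewrite -tr_s2 trmx_mul trmxK trP s2mx_mulC.
  rewrite s2mxD s2T tr0 trT subr0 -mulr2n -mulr_natl char2 mul0r add0r expr2.
  by rewrite /d /dickson.
by move=> h; apply: (addrI (s2mx (P *m A) - d)); rewrite addrAC -h subrK.
Qed.

End Dickson.

Lemma dickson_identity (L : fieldType) n (A g : 'M[L]_n) :
  2%:R = 0 :> L -> A + A^T \in unitmx ->
  in_identity_component (O_Q (qmx A)) g -> dickson A g = 0.
Proof.
move=> char2 B_unit [T [TO [T1 [Tg Tconn]]]].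
pose P := invmx (A + A^T).
pose X (i j : 'I_n) : {mpoly L[n * n]} := 'X_(mxvec_index i j).
have XE (C : 'M[L]_n) i j : (X i j).@[fun i => mxvec C 0 i] = C i j.
  by rewrite mevalXU mxvecE.
(* The trace pairs [P i j] with the entry (j, i), whence the condition [j < i]. *)
pose p : {mpoly L[n * n]} := \sum_i \sum_j P i j *: (if (j < i)%N then
   \sum_k (\sum_l A l k *: X j l) * X i k - (A j i)%:MP else 0).
have pE C : mx_eval p C = dickson A C.
  rewrite /mx_eval raddf_sum; apply: eq_bigr => i _; rewrite mxE raddf_sum.
  apply: eq_bigr => j _ /=; rewrite mevalZ mxE; congr (_ * _).
  case: ifP => _; last by rewrite raddf0.
  rewrite mevalB mevalC !mxE; congr (_ - _); rewrite raddf_sum; apply: eq_bigr => k _ /=.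
  rewrite mevalM XE !mxE; congr (_ * _); rewrite raddf_sum; apply: eq_bigr => l _ /=.
  by rewrite mevalZ XE mulrC.
have D01 C : T C -> dickson A C = 0 \/ dickson A C = 1.
  move=> /TO[_ /isometryP/dickson_idem-/(_ char2 B_unit)/eqP].
  rewrite -subr_eq0 expr2 -{3}[dickson A C]mulr1 -mulrBr mulf_eq0 subr_eq0.
  by case/orP=> /eqP; [left|right].
have cl (c : L) : zclosed_in T (fun C => T C /\ dickson A C = c).
  exists (fun r => r = p - c%:MP) => C; split=> -[TC h]; split=> //.
    by move=> _ ->; rewrite /mx_eval mevalB mevalC [_.@[_]]pE h subrr.
  have := h _ erefl; rewrite /mx_eval mevalB mevalC [p.@[_]]pE => /eqP.
  by rewrite subr_eq0 => /eqP.
case: (Tconn _ _ (cl 0) (cl 1)) => [C TC|C [[_ ->] [_ /eqP]]|h|h].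
- by case: (D01 C TC); [left|right].
- by rewrite eq_sym oner_eq0.
- exact: (h g Tg).2.
have := (h 1%:M T1).2; rewrite dickson1 // => /eqP.
by rewrite eq_sym oner_eq0.
Qed.

Lemma dickson_map (K L : fieldType) (f : {rmorphism K -> L}) n (A g : 'M[K]_n) :
  dickson (map_mx f A) (map_mx f g) = f (dickson A g).
Proof.
rewrite /dickson -trace_map_mx map_mxM map_invmx map_mxD map_trmx; congr (\tr (_ *m _)).
rewrite map_trmx -!map_mxM -map_mxB; apply/matrixP => i j; rewrite !mxE.
by case: ifP => _; rewrite ?rmorph0 // !mxE.
Qed.

(** Positions in the enumerating list make [K] countable, so that the closure of a countable field
    applies. *)
Lemma finite_algebraic_closure (K : fieldType) : finite_field K ->
  exists (L : closedFieldType) (f : {rmorphism K -> L}), algebraic_over f.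
Proof.
move=> [s sP].
have indexK : pcancel (fun x : K => index x s) (fun i => Some (nth 0 s i)).
  by move=> x; rewrite nth_index.
pose C : countFieldType := HB.pack_for countFieldType K (isCountable.Build K indexK).
have [L [f fL]] := countable_algebraic_closure C.
exists L, f => x; have [p pm px] := fL x.
by exists p; split=> //; apply: monic_neq0.
Qed.

Lemma dickson_SO (K : fieldType) n (A g : 'M[K]_n) :
  finite_field K \/ alg_closed K -> qform_mx (qmx A) = A ->
  2%:R = 0 :> K -> A + A^T \in unitmx -> SO_Q (qmx A) g -> dickson A g = 0.
Proof.
move=> + AE char2 B_unit [gcl gfin]; case=> [Kfin|Kcl]; last exact/dickson_identity/gcl.
have [_ gL] := gfin Kfin; have [L [f fL]] := finite_algebraic_closure Kfin.
have := gL L f fL; rewrite Qext_qmx AE => /dickson_identity.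
rewrite dickson_map => h; apply/eqP; rewrite -(fmorph_eq0 f) h //.
- by rewrite -(rmorph_nat f) char2 rmorph0.
by rewrite map_trmx -map_mxD map_unitmx.
Qed.

(** * One step of the filtration *)

Section Levels.
Variables (K : fieldType) (n : nat) (A N : 'M[K]_n) (p : nat).
Local Notation q := (qmx A).
Local Notation b := (bmx A).
Implicit Types (x y z w : 'rV[K]_n) (Y U W : 'M[K]_n).
Hypothesis rad_aniso : anisotropic_rad A.
Hypothesis N_isom : forall x, q (x *m N) = - b x (x *m N).
Hypothesis N_nil : N ^+ p = 0.

Lemma mulmx_expD x i j : x *m N ^+ i *m N ^+ j = x *m N ^+ (i + j).
Proof. by rewrite exprD -mulmxE mulmxA. Qed.

Lemma mulmx_expS x i : x *m N ^+ i *m N = x *m N ^+ i.+1.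
Proof. by rewrite -{2}[N]expr1 mulmx_expD addn1. Qed.

Lemma mulmx_exp_nil x i : (p <= i)%N -> x *m N ^+ i = 0.
Proof. by move=> le_pi; rewrite -(subnK le_pi) exprD N_nil mulr0 mulmx0. Qed.

Lemma bmx_mulN x y : b (x *m N) (y *m N) = - b x (y *m N) - b (x *m N) y.
Proof.
have := N_isom (x + y); rewrite mulmxDl qmxD !N_isom !bmxDl !bmxDr [b y (x *m N)]bmxC => h.
by apply: (addrI (- b x (x *m N) - b y (y *m N))); rewrite h; ring.
Qed.

(** Moves one [N] across b, up to sign and an error with one more factor [N]; nilpotency makes such
    errors accessible to descending induction. *)
Lemma bmx_mulN_shift x y : b (x *m N) y = - b x (y *m N) - b (x *m N) (y *m N).
Proof. by rewrite bmx_mulN; ring. Qed.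

Lemma mulmx_exp_stable U x i : stablemx U N -> (x <= U)%MS -> (x *m N ^+ i <= U)%MS.
Proof.
move=> sU xU; elim: i => [|i IH]; first by rewrite expr0 mulmx1.
by rewrite -mulmx_expS (submx_trans (submxMr N IH)).
Qed.

Lemma mulmx_stable U x : stablemx U N -> (x <= U)%MS -> (x *m N <= U)%MS.
Proof. by move=> sU xU; rewrite -[N]expr1 mulmx_exp_stable. Qed.

Lemma perp_stable U : stablemx U N -> stablemx (perp A U) N.
Proof.
move=> sU; apply/row_subP => i; rewrite row_mul; move: (row i _) (row_sub i (perp A U)) => x xU.
apply/perpP => y yU.
suff h j k : (p <= j + k)%N -> b (x *m N) (y *m N ^+ k) = 0.
  by have := h p 0%N (leq_addr _ _); rewrite expr0 mulmx1.
elim: j k => [|j IH] k le_p; first by rewrite mulmx_exp_nil ?bmx0r.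
rewrite bmx_mulN_shift mulmx_expS IH ?addnS -?addSn // oppr0 addr0.
by move/perpP: xU => ->; rewrite ?oppr0 // mulmx_exp_stable.
Qed.

Lemma rad_mulN x : (x <= radmx A)%MS -> x *m N = 0.
Proof.
move=> xR; have : (x *m N <= radmx A)%MS.
  have : (x *m N <= perp A 1%:M)%MS.
    apply: mulmx_stable; first by apply: perp_stable; apply: submx1.
    exact: submx_trans xR (radmx_perp _ _).
  by rewrite /perp trmx1 mulmx1.
move/rad_aniso; apply; rewrite N_isom.
by move/radmxP: xR => ->; rewrite oppr0.
Qed.

(** * Powers of N inside the polar form *)

Section Level.
Variables (a : nat) (Y : 'M[K]_n).
Hypotheses (Y_stable : stablemx Y N)
  (Y_level : forall x y, (x <= Y)%MS -> (y <= Y)%MS -> b x (y *m N ^+ a.+1) = 0).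

(** Induction on [i]. Shifting one [N] gives the exponents (i, j+1), covered by induction, and (i+1,
    j+1), covered by an inner induction descending from the vanishing power of [N]. *)
Lemma level_gt x y i j : (x <= Y)%MS -> (y <= Y)%MS -> (a < i + j)%N ->
  b (x *m N ^+ i) (y *m N ^+ j) = 0.
Proof.
move=> xY yY; elim: i j => [|i IH] j lt_a.
  rewrite expr0 mulmx1; rewrite add0n in lt_a.
  by rewrite -(subnK lt_a) -mulmx_expD Y_level // mulmx_exp_stable.
suff h k j' : (p <= j' + k)%N -> (a < i.+1 + j')%N -> b (x *m N ^+ i.+1) (y *m N ^+ j') = 0.
  by apply: (h p) => //; apply: leq_addl.
elim: k j' => [|k IHk] j' le_p lt_a'; first by rewrite addn0 in le_p; rewrite (mulmx_exp_nil y le_p) bmx0r.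
rewrite -mulmx_expS bmx_mulN_shift !mulmx_expS IH ?IHk ?oppr0 ?addr0 //; lia.
Qed.

Lemma level_eq x y i j : (x <= Y)%MS -> (y <= Y)%MS -> (i + j)%N = a ->
  b (x *m N ^+ i) (y *m N ^+ j) = (-1) ^+ i * b x (y *m N ^+ a).
Proof.
move=> xY yY; elim: i j => [|i IH] j ija.
  by rewrite expr0 mulmx1 expr0 mul1r -ija.
rewrite -mulmx_expS bmx_mulN_shift !mulmx_expS IH ?(addnS i) -?addSn //.
by rewrite (level_gt (i := i.+1)) // ?addnS ?ija // subr0 exprS mulN1r mulNr.
Qed.

End Level.

(** The invariant of the descending construction. The last two fields say that the orthogonal of [Y]
    is isotropic and equals its singular vectors plus the radical; with [good_rad], [Y] is then the
    orthogonal of a totally singular subspace. *)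
Record admissible a Y : Prop := Admissible {
  good_stable : stablemx Y N;
  good_rad : (radmx A <= Y)%MS;
  good_level : forall x y, (x <= Y)%MS -> (y <= Y)%MS -> b x (y *m N ^+ a.+1) = 0;
  good_q : forall x k, (x <= Y)%MS -> (a < k.*2)%N -> q (x *m N ^+ k) = 0;
  good_perp : forall x y, (x <= perp A Y)%MS -> (y <= perp A Y)%MS -> b x y = 0;
  good_split : forall z, (z <= perp A Y)%MS -> exists2 r, (r <= radmx A)%MS & q (z - r) = 0 }.

Definition in_step a Y x := [/\ (x <= Y)%MS, (x <= perp A (Y *m N ^+ a))%MS
  & ~~ odd a -> q (x *m N ^+ a./2) = 0].
Definition step a Y := spanp (in_step a Y).

Lemma step_perpP a Y x : (x <= perp A (Y *m N ^+ a))%MS <->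
  forall y, (y <= Y)%MS -> b x (y *m N ^+ a) = 0.
Proof.
split=> [/perpP h y yY|h]; first by apply: h; apply: submxMr.
by apply/perpP => _ /submxP[d ->]; rewrite mulmxA h ?submxMl.
Qed.

Lemma evenP a : ~~ odd a -> (a./2 + a./2)%N = a.
Proof. by move=> ev; rewrite addnn even_halfK. Qed.

(** The quadratic condition is linear here: its cross term is b(u, v N^a) up to sign, which the
    orthogonality condition kills. *)
Lemma stepP a Y x : admissible a Y -> (x <= step a Y)%MS <-> in_step a Y x.
Proof.
move=> gY; apply: spanpP; split; first by split; rewrite ?sub0mx // mul0mx qmx0.
move=> c u v [uY uP uq] [vY vP vq]; split; rewrite ?addmx_sub ?scalemx_sub // => ev.
rewrite mulmxDl -scalemxAl qmxD qmxZ uq // vq // mulr0 !add0r bmxZl.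
rewrite (level_eq (good_stable gY) (good_level gY)) ?evenP //.
by rewrite ((step_perpP _ _ _).1 uP) // !mulr0.
Qed.

(** The bound is [p.*2] because [good_q] concerns exponents k > a/2, for which N^k must vanish. *)
Lemma good_base a : (p.*2 <= a)%N -> admissible a 1%:M.
Proof.
move=> le_a.
have perp1 x : (x <= perp A 1%:M)%MS -> (x <= radmx A)%MS by rewrite /perp trmx1 mulmx1.
split=> [|||x k _ lt_a|x y xP _|z zP]; rewrite ?submx1 //.
- by move=> x y _ _; rewrite mulmx_exp_nil ?bmx0r // -leq_double (leq_trans le_a) // -addnn; apply: leq_trans (leq_addr _ _).
- by rewrite mulmx_exp_nil ?qmx0 // -leq_double (leq_trans le_a) // ltnW.
- by have /radmxP -> := perp1 _ xP.
by exists z; [apply: perp1|rewrite subrr qmx0].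
Qed.

Lemma singular_adds U W : (forall x, (x <= U)%MS -> q x = 0) -> (forall x, (x <= W)%MS -> q x = 0) ->
  (forall x y, (x <= U)%MS -> (y <= W)%MS -> b x y = 0) ->
  forall x, (x <= U + W)%MS -> q x = 0.
Proof.
move=> qU qW bUW _ /sub_addsmxP[[d e] /= ->].
by rewrite qmxD qU ?qW ?bUW ?submxMl ?addr0.
Qed.

Lemma singular_isotropic U : (forall x, (x <= U)%MS -> q x = 0) ->
  forall x y, (x <= U)%MS -> (y <= U)%MS -> b x y = 0.
Proof.
move=> qU x y xU yU; have := qmxD A x y.
by rewrite !qU ?addmx_sub // !add0r => <-.
Qed.

Lemma bmx_addrad x y r s : (r <= radmx A)%MS -> (s <= radmx A)%MS -> b (x + r) (y + s) = b x y.
Proof.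
move=> /radmxP rR /radmxP sR; rewrite bmxDl rR addr0 bmxDr.
by rewrite [b x s]bmxC sR addr0.
Qed.

Section Step.
Variables (a : nat) (Y : 'M[K]_n).
Hypotheses (a_gt0 : (0 < a)%N) (gY : admissible a Y).
(** The radical of (x, y) -> b(x, y N^a) on [Y]. For odd [a] it is the next level; for even [a] a
    quadratic condition is added. [W0] below is a totally singular subspace with orthogonal [Rd]. *)
Let Rd : 'M[K]_n := (Y :&: perp A (Y *m N ^+ a))%MS.
Definition singular_perp : 'M[K]_n := spanp (fun z => (z <= perp A Y)%MS /\ q z = 0).
Let W0 : 'M[K]_n := (singular_perp + Y *m N ^+ a)%MS.

Lemma singular_perpP z : (z <= singular_perp)%MS <-> (z <= perp A Y)%MS /\ q z = 0.
Proof.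
apply: (@spanpP _ _ (fun z => (z <= perp A Y)%MS /\ q z = 0)); split; first by rewrite sub0mx qmx0.
move=> c u v [uY qu] [vY qv]; rewrite addmx_sub ?scalemx_sub //; split=> //.
by rewrite qmxD qmxZ qu qv bmxZl (good_perp gY) // !mulr0 !addr0.
Qed.

Lemma perp_singular_perp : (perp A singular_perp :=: Y)%MS.
Proof.
apply/eqmxP/andP; split; last first.
  apply: submx_trans (sub_perpK A Y) (perpS _ _).
  by apply/rV_subP => z /singular_perpP[].
rewrite -(perpK (good_rad gY)) -(perp_addrad A singular_perp) perpS //.
apply/rV_subP => z zY; have [r rR qzr] := good_split gY zY.
rewrite -[z](subrK r) addmx_sub_adds //; apply/singular_perpP; split=> //.
by rewrite addmx_sub // eqmx_opp (submx_trans rR) ?radmx_perp.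
Qed.

Lemma RdY x : (x <= Rd)%MS -> (x <= Y)%MS.
Proof. by rewrite sub_capmx => /andP[]. Qed.

Lemma RdP x y : (x <= Rd)%MS -> (y <= Y)%MS -> b x (y *m N ^+ a) = 0.
Proof. by rewrite sub_capmx => /andP[_ /step_perpP]; apply. Qed.

Lemma mulN_Rd x : (x <= Y)%MS -> (x *m N <= Rd)%MS.
Proof.
move=> xY; rewrite sub_capmx (mulmx_stable (good_stable gY)) //=.
apply/step_perpP => y yY; rewrite -[N]expr1.
by rewrite (level_gt (good_stable gY) (good_level gY)).
Qed.

Lemma Rd_stable : stablemx Rd N.
Proof.
by apply/row_subP => i; rewrite row_mul mulN_Rd // RdY // row_sub.
Qed.

Lemma Rd_level x y : (x <= Rd)%MS -> (y <= Rd)%MS -> b x (y *m N ^+ a.-1.+1) = 0.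
Proof. by move=> xR yR; rewrite prednK // RdP // RdY. Qed.

Lemma W0_sing x : (x <= W0)%MS -> q x = 0.
Proof.
apply: singular_adds => {x} [x /singular_perpP[]//|_ /submxP[d ->]|x _ /singular_perpP[xY _] /submxP[d ->]].
  by rewrite mulmxA (good_q gY) ?submxMl // -addnn -addn1 leq_add2l.
by move/perpP: xY; apply; rewrite mulmxA (mulmx_exp_stable _ (good_stable gY)) ?submxMl.
Qed.

Lemma W0_perp : (W0 <= perp A Rd)%MS.
Proof.
rewrite addsmx_sub; apply/andP; split.
  apply/rV_subP => z /singular_perpP[zY _]; apply: submx_trans zY (perpS _ _); apply: capmxSl.
apply: submx_trans (sub_perpK A _) (perpS _ _); apply: capmxSr.
Qed.

Lemma perp_W0 x : (x <= perp A W0)%MS -> (x <= Rd)%MS.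
Proof. by rewrite perp_adds perp_singular_perp sub_capmx. Qed.

Lemma perp_Rd : (perp A Rd <= W0 + radmx A)%MS.
Proof.
rewrite -(perp_perp A W0) perpS //; apply/rV_subP; exact: perp_W0.
Qed.

Lemma step_Rd x : (x <= step a Y)%MS -> (x <= Rd)%MS.
Proof. by case/(stepP _ gY) => xY xP _; rewrite sub_capmx xY. Qed.

Lemma Rd_step x : (x <= Rd)%MS -> (~~ odd a -> q (x *m N ^+ a./2) = 0) -> (x <= step a Y)%MS.
Proof. by rewrite sub_capmx => /andP[xY xP] xq; apply/stepP. Qed.

Lemma mulN_step x : (x <= Y)%MS -> (x *m N <= step a Y)%MS.
Proof.
move=> xY; apply: Rd_step (mulN_Rd xY) _ => ev.
have -> : x *m N *m N ^+ a./2 = x *m N ^+ (a./2).+1.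
  by rewrite -{1}[N]expr1 mulmx_expD add1n.
by rewrite (good_q gY) // doubleS -addnn evenP // ltnS leqW.
Qed.

(* For x in Rd, q(x N^k) = +- b(x, x N^(a-1)) where a = 2k. *)
Lemma q_half x : ~~ odd a -> (x <= Rd)%MS ->
  (x <= perp A (Rd *m N ^+ a.-1))%MS -> q (x *m N ^+ a./2) = 0.
Proof.
move=> ev xR /step_perpP xP; have aE := evenP ev.
have k_gt0 : (0 < a./2)%N by case: (a./2) aE a_gt0 => // <-.
rewrite -(prednK k_gt0) -mulmx_expS N_isom mulmx_expS prednK //.
rewrite (level_eq Rd_stable Rd_level) ?xP ?mulr0 ?oppr0 //.
by move: aE k_gt0; lia.
Qed.

(** Dual form of [q_half]: a vector orthogonal to [W0] and to Rd N^(a-1) lies in the next level. *)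
Lemma perp_step : ~~ odd a -> (perp A (step a Y) <= W0 + Rd *m N ^+ a.-1 + radmx A)%MS.
Proof.
move=> ev; apply: perp_sub_adds => x /perp_W0 xR xP.
by apply: (Rd_step xR) => _; apply: q_half.
Qed.

(** Only the conditions on the orthogonal need an argument; the others pass from [Y] to the next
    level, the new case 2k = a of [good_q] being the quadratic condition itself. *)
Lemma good_step_of :
  (forall x y, (x <= perp A (step a Y))%MS -> (y <= perp A (step a Y))%MS -> b x y = 0) ->
  (forall z, (z <= perp A (step a Y))%MS -> exists2 r, (r <= radmx A)%MS & q (z - r) = 0) ->
  admissible a.-1 (step a Y).
Proof.
move=> hP hS; split=> //.
- by apply/row_subP => i; rewrite row_mul mulN_step // RdY // step_Rd // row_sub.
- apply/rV_subP => x xR; apply/stepP => //; split.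
  + exact: submx_trans xR (good_rad gY).
  + exact: submx_trans xR (radmx_perp _ _).
  move=> ev; have k_gt0 : (0 < a./2)%N by case: (a./2) (evenP ev) a_gt0 => // <-.
  by rewrite -(prednK k_gt0) exprS -mulmxE mulmxA rad_mulN // mul0mx qmx0.
- by move=> x y /step_Rd xR /step_Rd yR; apply: Rd_level.
move=> x k /(stepP _ gY)[xY _ xq]; rewrite -ltnS prednK // ltnS leq_eqVlt => /orP[/eqP ak|].
  by have := xq; rewrite ak odd_double doubleK; apply.
exact: good_q gY _ _ xY.
Qed.

Lemma good_step_singular W : (forall x, (x <= W)%MS -> q x = 0) ->
  (perp A (step a Y) <= W + radmx A)%MS -> admissible a.-1 (step a Y).
Proof.
move=> qW pW; apply: good_step_of => [x y xP yP|z zP].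
  have /sub_addsmxP[[d e] /= ->] := submx_trans xP pW.
  have /sub_addsmxP[[d' e'] /= ->] := submx_trans yP pW.
  by rewrite bmx_addrad ?submxMl // (singular_isotropic qW) ?submxMl.
have /sub_addsmxP[[d e] /= ->] := submx_trans zP pW.
by exists (e *m radmx A); rewrite ?submxMl // addrK qW ?submxMl.
Qed.

Lemma good_step_Rd : (Rd <= step a Y)%MS -> admissible a.-1 (step a Y).
Proof.
move=> RdS; apply: (good_step_singular W0_sing).
exact: submx_trans (perpS _ RdS) perp_Rd.
Qed.

Lemma good_step_odd : odd a -> admissible a.-1 (step a Y).
Proof.
move=> oa; apply: good_step_Rd; apply/rV_subP => x xR.
by apply: Rd_step => //; rewrite oa.
Qed.

(** When 2 is invertible the quadratic condition follows from orthogonality, since 2 q(x N^(a/2)) is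
    b(x, x N^a) up to sign. *)
Lemma good_step_neq2 : 2%:R != 0 :> K -> admissible a.-1 (step a Y).
Proof.
move=> n2; apply: good_step_Rd; apply/rV_subP => x xR; apply: Rd_step => // ev.
apply/eqP; rewrite -(mulrI_eq0 _ (mulfI n2)) mulr_natl -bmxx.
rewrite (level_eq (good_stable gY) (good_level gY)) ?evenP ?RdY //.
by rewrite RdP ?mulr0 // RdY.
Qed.

(** For a > 2 one has 2(a-1) > a, so the extra summand Rd N^(a-1) is singular by [good_q]. *)
Lemma good_step_even : ~~ odd a -> (2 < a)%N -> admissible a.-1 (step a Y).
Proof.
move=> ev lt2a; apply: good_step_singular (perp_step ev) => x.
apply: singular_adds => {x} [||x _ xW /submxP[d ->]]; first exact: W0_sing.
  move=> _ /submxP[d ->]; rewrite mulmxA (good_q gY) ?RdY ?submxMl //.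
  by move: lt2a; rewrite -addnn; lia.
have /perpP := submx_trans xW W0_perp; apply.
by rewrite mulmxA (mulmx_exp_stable _ Rd_stable) ?submxMl.
Qed.

End Step.

(** * The exceptional step a = 2 in characteristic 2 *)

Section StepTwo.
Variable (Y : 'M[K]_n).
Hypotheses (gY : admissible 2 Y) (char2 : 2%:R = 0 :> K)
  (perfect : forall c : K, exists t, t ^+ 2 = c).
Let Rd : 'M[K]_n := (Y :&: perp A (Y *m N ^+ 2))%MS.
Let W0 : 'M[K]_n := (singular_perp Y + Y *m N ^+ 2)%MS.

Lemma Rd2_bmx x y : (x <= Rd)%MS -> (y <= Rd)%MS -> b (x *m N) (y *m N) = 0.
Proof.
move=> xR yR; rewrite -[N]expr1.
exact: (level_gt (Rd_stable gY) (@Rd_level 2 Y isT)).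
Qed.

Lemma step_two_isotropic x y :
  (x <= perp A (step 2 Y))%MS -> (y <= perp A (step 2 Y))%MS -> b x y = 0.
Proof.
have pS := @perp_step 2 Y isT gY isT; rewrite expr1 -/Rd -/W0 in pS.
move=> /submx_trans/(_ pS)/sub_addsmxP[[d e] /= ->] /submx_trans/(_ pS)/sub_addsmxP[[d' e'] /= ->].
rewrite bmx_addrad ?submxMl //.
have /sub_addsmxP[[w u] /= ->] := submxMl d (W0 + Rd *m N)%MS.
have /sub_addsmxP[[w' u'] /= ->] := submxMl d' (W0 + Rd *m N)%MS.
have cross v c : b (v *m W0) (c *m (Rd *m N)) = 0.
  have /perpP := submx_trans (submxMl v W0) (W0_perp gY); apply.
  by rewrite mulmxA (mulmx_stable (Rd_stable gY)) ?submxMl.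
rewrite bmxDl !bmxDr [b (u *m _) (w' *m _)]bmxC !cross !mulmxA Rd2_bmx ?submxMl //.
by rewrite (singular_isotropic (@W0_sing 2 Y isT gY)) ?submxMl // !addr0.
Qed.

(* If q z <> 0 then g = 1 + N differs by the reflection in v = xN from an element of the
   unipotent radical of a parabolic subgroup, so its Dickson invariant is 1. *)
Lemma step_two_singular z : (forall x, (x <= radmx A)%MS -> x = 0) ->
  (forall g, SO_Q q g -> dickson A g = 0) -> qform_mx q = A -> SO_Q q (1%:M + N) ->
  (z <= perp A (step 2 Y))%MS -> q z = 0.
Proof.
move=> rad0 dSO AE gSO zP; apply/eqP; apply: contraT => qz.
have rad_sub m (U : 'M[K]_(m, n)) : (radmx A <= U)%MS.
  by apply/rV_subP => r /rad0 ->; apply: sub0mx.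
have sR : stablemx Rd N := Rd_stable gY.
have pS := @perp_step 2 Y isT gY isT; rewrite expr1 -/Rd -/W0 in pS.
have W0sing x : (x <= W0)%MS -> q x = 0 by apply: (@W0_sing 2 Y isT gY).
have W0P : (W0 <= perp A Rd)%MS := W0_perp gY.
have PRd : (perp A Rd <= W0)%MS.
  by apply: submx_trans (perp_Rd gY) _; rewrite addsmx_sub submx_refl rad_sub.
have PRd_b w y : (w <= perp A Rd)%MS -> (y <= Rd)%MS -> b w y = 0 by move=> /perpP h /h.
have := submx_trans zP pS => /sub_addsmxP[[d e] /= zE].
rewrite (rad0 (e *m radmx A)) ?submxMl // addr0 in zE.
have /sub_addsmxP[[d1 e1] /= wE] := submxMl d (W0 + Rd *m N)%MS.
rewrite wE mulmxA in zE; set w := d1 *m W0 in zE; set x := e1 *m Rd in zE.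
have wW : (w <= W0)%MS by apply: submxMl.
have xR : (x <= Rd)%MS by apply: submxMl.
have wP := submx_trans wW W0P.
pose v := x *m N; have vR : (v <= Rd)%MS by apply: mulmx_stable.
have qv : q v != 0 by move: qz; rewrite zE qmxD W0sing // PRd_b // add0r addr0.
have vP : (v <= perp A (step 2 Y))%MS.
  have -> : v = z - w by rewrite zE addrAC subrr add0r.
  rewrite addmx_sub // eqmx_opp; apply: submx_trans wP (perpS _ _).
  by apply/rV_subP => y; apply: step_Rd.
have dbl c : c + c = 0 :> K by rewrite -mulr2n -mulr_natr char2 mulr0.
have bxv : b x v = - q v by rewrite /v N_isom opprK.
(* With t^2 = q(y N) / q(v), the vector y - t x satisfies the quadratic condition, so it lies in the
   next level and is orthogonal to v. *)
have qN y : (y <= Rd)%MS -> q (y *m N) * q v = b y v ^+ 2.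
  move=> yR; have [t tE] := perfect (q (y *m N) / q v).
  have : (y - t *: x <= step 2 Y)%MS.
    apply: Rd_step => [||_] //; first by rewrite addmx_sub // eqmx_opp scalemx_sub.
    rewrite expr1 mulmxBl qmxD qmxN -scalemxAl qmxZ bmxNr bmxZr Rd2_bmx // mulr0 oppr0 addr0.
    by rewrite tE -/v divfK // dbl.
  move: vP => /perpP h /h; rewrite bmxC bmxDl bmxNl bmxZl bxv mulrN opprK => /eqP.
  rewrite addr_eq0 => /eqP ->; rewrite sqrrN exprMn tE expr2 mulrA divfK //.
have bNv y : (y <= Rd)%MS -> b (y *m N) v = 0 by move=> yR; apply: Rd2_bmx.
have bvv : b v v = 0 by rewrite bNv.
pose g : 'M[K]_n := 1%:M + N; pose g' : 'M[K]_n := g *m reflmx A v; pose N' : 'M[K]_n := g' - 1%:M.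
have N'E y : y *m N' = y *m N - (b (y + y *m N) v / q v) *: v.
  by rewrite mulmxBr mulmx1 mulmxA reflmxE mulmxDr mulmx1 addrAC [y + _]addrC addrK.
have N'R y : (y <= Rd)%MS -> y *m N' = y *m N - (b y v / q v) *: v.
  by move=> yR; rewrite N'E bmxDl bNv // addr0.
have sR' y : (y <= Rd)%MS -> (y *m N' <= Rd)%MS.
  by move=> yR; rewrite N'R // addmx_sub ?mulmx_stable // eqmx_opp scalemx_sub.
have sP : stablemx (perp A Rd) N := perp_stable sR.
have N'P w' : (w' <= perp A Rd)%MS -> w' *m N' = w' *m N.
  by move=> w'P; rewrite N'E PRd_b ?addmx_sub ?mulmx_stable // mul0r scale0r subr0.
(* By [qN] both squares equal q(y N) and the cross term is 0, so the result is a double. *)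
have qN' y : (y <= Rd)%MS -> q (y *m N') = 0.
  move=> yR; rewrite N'R // qmxD qmxN bmxNr bmxZr bNv // mulr0 oppr0 addr0 qmxZ.
  have -> : (b y v / q v) ^+ 2 * q v = q (y *m N) by rewrite exprMn -qN //; field.
  exact: dbl.
(* The totally singular subspace defining the parabolic: its orthogonal lies in the double
   orthogonal of [Rd], that is in [Rd], which N' maps into [U]. *)
pose U := (perp A Rd + Rd *m N')%MS.
have UN' : (U *m N' <= U)%MS.
  rewrite addsmxMr addsmx_sub; apply/andP; split.
    apply: submx_trans (addsmxSl _ _); apply/row_subP => i; rewrite row_mul.
    by rewrite N'P ?mulmx_stable // row_sub.
  apply: submx_trans (addsmxSr _ _); apply: submxMr.
  by apply/row_subP => i; rewrite row_mul sR' // row_sub.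
have isom_g y : q (y *m g) = q y.
  by rewrite mulmxDr mulmx1 qmxD N_isom -addrA addNr addr0.
have isom_g' y : q (y *m g') = q y.
  by rewrite mulmxA reflmx_isometry // isom_g.
(* N and N' agree modulo [Rd], so [p] steps lead into [Rd]; two more lead into its orthogonal, where
   N' = N, and [p] more give 0. *)
have nil' : N' ^+ (p + 2 + p) = 0.
  have h1 y j : (y *m N' ^+ j - y *m N ^+ j <= Rd)%MS.
    elim: j => [|j IH]; first by rewrite !expr0 subrr sub0mx.
    rewrite !exprSr -!mulmxE !mulmxA.
    have -> : y *m N' ^+ j *m N' - y *m N ^+ j *m N =
        (y *m N' ^+ j - y *m N ^+ j) *m N' + (y *m N ^+ j *m N' - y *m N ^+ j *m N).
      by rewrite mulmxBl addrA subrK.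
    rewrite addmx_sub ?sR' // N'E addrAC subrr add0r eqmx_opp scalemx_sub //.
  have h2 y : (y <= Rd)%MS -> (y *m N' *m N' <= perp A Rd)%MS.
    move=> yR; rewrite N'R ?sR' // N'R //.
    rewrite bmxDl bNv // bmxNl bmxZl bvv mulr0 oppr0 addr0 mul0r scale0r subr0 mulmxBl.
    have N2 u : (u <= Rd)%MS -> (u *m N *m N <= perp A Rd)%MS.
      move=> uR; apply: submx_trans W0P; apply: submx_trans (addsmxSr _ _).
      by rewrite -mulmxA mulmxE -expr2 submxMr // (submx_trans uR) // capmxSl.
    by rewrite addmx_sub ?N2 // eqmx_opp -scalemxAl scalemx_sub // N2.
  have h3 w' j : (w' <= perp A Rd)%MS -> w' *m N' ^+ j = w' *m N ^+ j.
    move=> w'P; elim: j => [|j IH]; first by rewrite !expr0.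
    by rewrite !exprSr -!mulmxE !mulmxA IH N'P // mulmx_exp_stable.
  apply/row_matrixP => i; rewrite row0 rowE !exprD -!mulmxE !mulmxA.
  have := h1 (delta_mx 0 i) p; rewrite N_nil mulmx0 subr0 => /h2/h3 ->.
  by rewrite N_nil mulmx0.
have SOg' : SO_Q q g'.
  apply: (SO_parabolic (U := U) rad_aniso isom_g' nil' _ _ _ AE).
  - apply: singular_adds => [u uP|_ /submxP[d2 ->]|u _ uP /submxP[d2 ->]].
    + by apply: W0sing; apply: submx_trans uP PRd.
    + by rewrite mulmxA qN' ?submxMl.
    by rewrite mulmxA PRd_b ?sR' ?submxMl.
  - have -> : g' = 1%:M + N' by rewrite addrC subrK.
    by rewrite mulmxDr mulmx1 addmx_sub.
  apply: submx_trans (addsmxSr _ _); apply: submxMr.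
  rewrite -(perpK (rad_sub _ Rd)); apply: perpS; apply: addsmxSl.
have B_unit : A + A^T \in unitmx.
  rewrite -row_free_unit -kermx_eq0 -submx0.
  by apply/rV_subP => y /rad0 ->; apply: sub0mx.
have := dSO _ SOg'; rewrite dicksonM //; try exact/isometryP; last first.
  exact/isometryP/reflmx_isometry.
by rewrite dSO // dickson_refl // add0r => /eqP; rewrite oner_eq0.
Qed.

(** A nonzero radical vector, suitably scaled over the perfect field, corrects the value of q;
    otherwise the polar form is nondegenerate and the Dickson invariant is available. *)
Lemma good_step_two : (forall g, A + A^T \in unitmx -> SO_Q q g -> dickson A g = 0) ->
  qform_mx q = A -> SO_Q q (1%:M + N) -> admissible 1 (step 2 Y).
Proof.
move=> dSO AE gSO; apply: (@good_step_of 2 Y isT gY step_two_isotropic) => z zP.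
have [[r [rR r0]]|noR] := classic (exists r : 'rV[K]_n, (r <= radmx A)%MS /\ r <> 0).
  have qr : q r != 0 by apply/eqP => /(rad_aniso rR).
  have [t tE] := perfect (q z / q r).
  exists (t *: r); first exact: scalemx_sub.
  rewrite qmxD qmxN qmxZ tE divfK // bmxNr bmxZr bmxC.
  by move/radmxP: rR => ->; rewrite mulr0 oppr0 addr0 -mulr2n -mulr_natr char2 mulr0.
have rad0 x : (x <= radmx A)%MS -> x = 0.
  by move=> xR; apply: NNPP => x0; apply: noR; exists x.
exists 0; first exact: sub0mx.
rewrite subr0 (step_two_singular rad0 _ AE gSO zP) // => g; apply: dSO.
rewrite -row_free_unit -kermx_eq0 -submx0.
by apply/rV_subP => y /rad0 ->; apply: sub0mx.
Qed.

End StepTwo.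

(** * The descending flag, [flag M j] being the level of index M - j *)

Fixpoint flag M j : 'M[K]_n := if j is j'.+1 then step (M - j') (flag M j') else 1%:M.

Lemma flag_exists :
  (forall a Y, admissible a.+1 Y -> admissible a (step a.+1 Y)) ->
  exists Y : nat -> 'M[K]_n, [/\ forall a, admissible a (Y a),
    forall a x, (x <= Y a)%MS <-> in_step a.+1 (Y a.+1) x &
    forall a, (p.*2 <= a)%N -> Y a = 1%:M].
Proof.
move=> good_next; set M := p.*2; exists (fun a => flag M (M - a)).
have big a : (M <= a)%N -> flag M (M - a) = 1%:M by rewrite -subn_eq0 => /eqP ->.
have eqn a : (a < M)%N -> flag M (M - a) = step a.+1 (flag M (M - a.+1)).
  by move=> lt_a; rewrite -(subnSK lt_a) /= subKn.
have gd a : admissible a (flag M (M - a)).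
  have [le_a|lt_a] := leqP M a; first by rewrite big //; apply: good_base.
  suff H j : (j <= M)%N -> admissible (M - j) (flag M (M - (M - j))).
    by have := H (M - a)%N (leq_subr _ _); rewrite subKn // ltnW.
  elim: j => [|j IH] lt_j; first by rewrite subn0 big //; apply: good_base.
  rewrite eqn; last by move: lt_j; lia.
  by apply: good_next; rewrite subnSK //; apply: IH; apply: ltnW.
split=> // a x; have [le_a|lt_a] := leqP M a.
  rewrite !big ?(leq_trans le_a) // submx1; split=> // _.
  have N0 : N ^+ a.+1 = 0.
    rewrite -(subnK (_ : p <= a.+1)%N) ?exprD ?N_nil ?mulr0 //.
    by rewrite (leq_trans _ (leqW le_a)) // /M -addnn leq_addr.
  split; rewrite ?submx1 ?N0 ?mulmx0 //.
    by apply/perpP => y; rewrite submx0 => /eqP ->; rewrite bmx0r.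
  move=> ev; rewrite mulmx_exp_nil ?qmx0 //.
  by rewrite -leq_double -[(a.+1)./2.*2]addnn evenP // leqW.
by rewrite eqn //; apply: stepP.
Qed.

End Levels.

(** * The filtration *)

Section Flag.
Variables (K : fieldType) (n : nat) (A N : 'M[K]_n) (p : nat).
Local Notation q := (qmx A).
Local Notation b := (bmx A).
Implicit Types (x y z w : 'rV[K]_n) (U W : 'M[K]_n).
Hypothesis rad_aniso : anisotropic_rad A.
Hypothesis N_isom : forall x, q (x *m N) = - b x (x *m N).
Hypothesis N_nil : N ^+ p = 0.
Variable Y : nat -> 'M[K]_n.
Hypothesis Y_good : forall a, admissible A N a (Y a).
Hypothesis Y_step : forall a x, (x <= Y a)%MS <-> in_step A N a.+1 (Y a.+1) x.
Hypothesis Y_full : forall a, (p.*2 <= a)%N -> Y a = 1%:M.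

Lemma flag_nested a x : (x <= Y a)%MS -> (x <= Y a.+1)%MS.
Proof. by case/Y_step. Qed.

Lemma flag_bmx a x y : (x <= Y a)%MS -> (y <= Y a.+1)%MS -> b x (y *m N ^+ a.+1) = 0.
Proof. by case/Y_step => _ /step_perpP h _; apply: h. Qed.

Lemma flag_mulN a x : (x <= Y a.+1)%MS -> (x *m N <= Y a)%MS.
Proof.
move=> xY; apply/Y_step; apply/(stepP N_isom N_nil) => //.
exact: (mulN_step N_isom N_nil).
Qed.

Lemma flag_level a x y i j : (x <= Y a)%MS -> (y <= Y a)%MS -> (i + j)%N = a ->
  b (x *m N ^+ i) (y *m N ^+ j) = (-1) ^+ i * b x (y *m N ^+ a).
Proof.
exact: (level_eq N_isom N_nil (good_stable (Y_good a)) (good_level (Y_good a))).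
Qed.

Lemma flag_mulN2 a x : (x <= Y a.+2)%MS -> (x *m N <= Y a)%MS.
Proof.
move=> xY; apply/Y_step; split; first exact: flag_mulN.
  apply/step_perpP => y yY; have yY2 := flag_nested yY.
  have h := flag_level (i := 1) (j := a.+1) xY yY2 erefl.
  rewrite expr1 in h; rewrite h.
  (* b(y, x N^(a+2)) vanishes by the recursion, and up to sign it is b(x, y N^(a+2)). *)
  have := flag_level (i := a.+2) (j := 0) xY yY2 (addn0 _).
  rewrite expr0 mulmx1 bmxC flag_bmx // => /esym/eqP.
  by rewrite mulf_eq0 signr_eq0 /= => /eqP ->; rewrite mulr0.
move=> ev; rewrite -{1}[N]expr1 mulmx_expD (good_q (Y_good a.+2)) //.
by move: ev; rewrite add1n doubleS -addnn; lia.
Qed.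

(** [Negz a] stands for -(a+1), whence the shift. In positive degree the orthogonal of [Y a]
    contains the radical, so only its singular vectors are kept. *)
Definition filtration_of_flag (c : int) : 'M[K]_n :=
  match c with Posz 0 => Y 0 | Posz a.+1 => singular_perp A (Y a) | Negz a => Y a.+1 end.

Lemma filt_neg a : filtration_of_flag (- a%:Z) = Y a.
Proof. by case: a. Qed.

Lemma filt_neg1 a : filtration_of_flag (- a.+1%:Z + 1) = Y a.
Proof. by rewrite (_ : - a.+1%:Z + 1 = - a%:Z) ?filt_neg //; lia. Qed.

Lemma filt_decr c : (filtration_of_flag (c + 1) <= filtration_of_flag c)%MS.
Proof.
apply/rV_subP => x; case: c => [[|a]|a].
- case/(singular_perpP (Y_good 0)) => x0 qx.
  rewrite -(perp_singular_perp (Y_good 0)); apply/perpP => y /(singular_perpP (Y_good 0))[y0 _].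
  exact: (good_perp (Y_good 0)).
- rewrite (_ : a.+1%:Z + 1 = a.+2%:Z) /=; last by lia.
  case/(singular_perpP (Y_good _)) => xa qx; apply/(singular_perpP (Y_good _)); split=> //.
  apply/perpP => y ya; move/perpP: xa; apply; exact: flag_nested.
by rewrite (_ : Negz a + 1 = - a%:Z) ?filt_neg /=; [exact: flag_nested|lia].
Qed.

Lemma filt_Qfiltration : Qfiltration q filtration_of_flag.
Proof.
split; first exact: filt_decr; split.
  exists (p.*2.+1)%:Z; case=> [[|a]|a] // le_a; apply/rV_subP => x /(singular_perpP (Y_good _))[].
  rewrite Y_full; last by move: le_a; lia.
  by rewrite /perp trmx1 mulmx1 => xR qx; rewrite (rad_aniso xR) ?sub0mx.
split.
  exists (- (p.*2.+1)%:Z); case=> [a|a] le_a; first by move: le_a; lia.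
  by rewrite /= Y_full ?row_full_unit ?unitmx1 //; move: le_a; lia.
case=> [[|a]|a] // _; split; first by move=> x /(singular_perpP (Y_good _))[].
move=> x; rewrite (_ : 1 - a.+1%:Z = - a%:Z); last by lia.
rewrite filt_neg -(perp_singular_perp (Y_good a)); split=> [/perpP h y ya|h].
  by rewrite bil_qmx h.
by apply/perpP => y ya; rewrite -bil_qmx h.
Qed.

(** The cases are c = 0, c > 0, c = -1 and c < -1; for c > 0 the claim is dual to [flag_mulN2]. *)
Lemma filt_mulN c x : (x <= filtration_of_flag c)%MS -> (x *m N <= filtration_of_flag (c + 2))%MS.
Proof.
case: c => [[|a]|[|a]].
- move=> x0; have x1 := flag_nested x0.
  apply/(singular_perpP (Y_good 1)); split; last first.
    by rewrite -[N]expr1; apply: (good_q (Y_good 1)).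
  apply/perpP => y y1; rewrite (bmx_mulN_shift N_isom).
  have g1 := level_gt N_isom N_nil (good_stable (Y_good 1)) (good_level (Y_good 1))
    (i := 1) (j := 1) x1 y1 isT.
  have h1 := flag_bmx x0 y1.
  by rewrite !expr1 in g1 h1; rewrite g1 h1 oppr0 addr0.
- rewrite (_ : a.+1%:Z + 2 = a.+3%:Z) /=; last by lia.
  case/(singular_perpP (Y_good _)) => xa qx; have xNa : (x *m N <= perp A (Y a))%MS.
    by apply: mulmx_stable xa; apply: (perp_stable N_isom N_nil (good_stable (Y_good a))).
  apply/(singular_perpP (Y_good _)); split; last by rewrite N_isom (good_perp (Y_good a)) ?oppr0.
  apply/perpP => y /flag_mulN2 ya; rewrite (bmx_mulN_shift N_isom).
  by move/perpP: xa => ->; rewrite // oppr0 add0r; move/perpP: xNa => ->; rewrite ?oppr0.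
- move=> x1; apply/(singular_perpP (Y_good 0)); split; last first.
    by rewrite -[N]expr1; apply: (good_q (Y_good 1)).
  by apply/perpP => y y0; rewrite bmxC -[N]expr1; apply: flag_bmx.
rewrite (_ : Negz a.+1 + 2 = - a%:Z) ?filt_neg; first exact: flag_mulN2.
by lia.
Qed.

Lemma polar_pow x z k : q ((x + z) *m N ^+ k) - q (x *m N ^+ k) - q (z *m N ^+ k)
  = b (x *m N ^+ k) (z *m N ^+ k).
Proof. by rewrite mulmxDl qmxD; ring. Qed.

Lemma filt_Estar : Estar q filtration_of_flag N.
Proof.
split; first by split; [split; [exists p|move=> x; rewrite bil_qmx]|exact: filt_mulN].
split=> [a ev bq x y|[//|a] oa x]; last first.
  rewrite filt_neg filt_neg1 => xa h; apply/Y_step; split=> //; last by rewrite oa.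
  by apply/step_perpP => y ya; rewrite -bil_qmx h.
rewrite filt_neg => xa ya hx hy hxy; rewrite {}/bq in hx hy.
have ua : (x - y <= Y a)%MS by rewrite addmx_sub // eqmx_opp.
have bx z : (z <= Y a)%MS -> b (x *m N ^+ a./2) (z *m N ^+ a./2) = 0.
  by move=> za; rewrite -polar_pow; apply: hx.
have by_ z : (z <= Y a)%MS -> b (y *m N ^+ a./2) (z *m N ^+ a./2) = 0.
  by move=> za; rewrite -polar_pow; apply: hy.
have bu z : (z <= Y a)%MS -> b (x - y) (z *m N ^+ a) = 0.
  move=> za; have b0 : b ((x - y) *m N ^+ a./2) (z *m N ^+ a./2) = 0.
    by rewrite mulmxBl bmxDl bmxNl bx // by_ // subr0.
  have /esym/eqP := flag_level (i := a./2) (j := a./2) ua za (evenP ev).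
  by rewrite b0 mulf_eq0 signr_eq0 /= => /eqP.
(* The value is 2 q(x N^k) with k = a/2, that is b(x N^k, x N^k), which is 0. *)
have qu : q ((x - y) *m N ^+ a./2) = 0.
  rewrite mulmxBl qmxD qmxN bmxNr bx // oppr0 addr0 -hxy -mulr2n -bmxx; exact: bx.
case: a ev xa ya hx hy hxy ua bx by_ bu qu => [|a] ev xa ya hx hy hxy ua bx by_ bu qu.
  apply/(singular_perpP (Y_good 0)); split; last by rewrite expr0 mulmx1 in qu.
  by apply/perpP => z /bu; rewrite expr0 mulmx1.
by rewrite filt_neg1; apply/Y_step; split=> //; apply/step_perpP.
Qed.

(** * Uniqueness of the filtration *)

Section Uniqueness.
Variable X : int -> 'M[K]_n.
Hypotheses (X_filt : Qfiltration q X) (X_star : Estar q X N).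

Lemma filt_expN c x j : (x <= X c)%MS -> (x *m N ^+ j <= X (c + j.*2%:Z)%R)%MS.
Proof.
move=> xc; elim: j => [|j IH]; first by rewrite expr0 mulmx1 addr0.
rewrite -mulmx_expS (_ : c + j.+1.*2%:Z = c + j.*2%:Z + 2); last by lia.
by case: X_star => -[_ h] _; apply: h.
Qed.

(** Descending induction from a degree where both spaces are V, showing that X satisfies the
    recursion of [Y]. *)
Lemma filt_unique_neg a x : (x <= X (- a%:Z)%R)%MS <-> (x <= Y a)%MS.
Proof.
have [Xdec [_ [[a1 Xfull] Xperp]]] := X_filt; have [_ [X_even X_odd]] := X_star.
pose M := (p.*2 + absz a1)%N.
have full c z : (M <= c)%N -> (z <= X (- c%:Z)%R)%MS <-> (z <= Y c)%MS.
  move=> le_c; rewrite Y_full ?submx1; last by apply: leq_trans le_c; apply: leq_addr.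
  by split=> // _; apply: submx_full; apply: Xfull; move: le_c; rewrite /M; lia.
suff H j c z : (M <= c + j)%N -> (z <= X (- c%:Z)%R)%MS <-> (z <= Y c)%MS.
  by apply: (H M); apply: leq_addl.
elim: j c z => [|j IH] c z le_M; first by apply: full; rewrite -[c]addn0.
have {}IH w : (w <= X (- c.+1%:Z)%R)%MS <-> (w <= Y c.+1)%MS by apply: IH; rewrite addSnnS.
have cE : - c.+1%:Z + 1 = - c%:Z by lia.
split=> zc.
  have zc1 : (z <= X (- c.+1%:Z)%R)%MS.
    by apply: submx_trans zc _; rewrite -cE; apply: Xdec.
  have Xc1 (c' : int) : c' = c.+1%:Z -> (forall y, (y <= X c')%MS -> q y = 0) /\
      (forall y, (y <= X c')%MS -> b z y = 0).
    move=> ->; have [qX /(_ z)[perpX _]] := Xperp c.+1%:Z isT.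
    split=> // y yX; rewrite -bil_qmx perpX //.
    by rewrite (_ : 1 - _ = - c%:Z); last by lia.
  apply/Y_step; split; first by apply/IH.
    apply/step_perpP => y /IH/(filt_expN c.+1) yN.
    (* N^(c+1) maps X^(-c-1) into X^(c+1), whose orthogonal is X^(-c). *)
    have h : - c.+1%:Z + c.+1.*2%:Z = c.+1%:Z by lia.
    exact: (Xc1 _ h).2 _ yN.
  move=> ev; have := filt_expN (c.+1)./2 zc; have ev2 := evenP ev.
  have [qX _] := Xperp 1 isT.
  by rewrite (_ : _ + _ = 1); [exact: qX|move: ev2; rewrite -addnn; lia].
have [zc1 /step_perpP zP qz] := (Y_step c z).1 zc.
rewrite -cE; have [oc|ec] := boolP (odd c.+1).
  apply: X_odd => //; first by apply/IH.
  by move=> y /IH yc; rewrite bil_qmx zP.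
(* Nondegeneracy is applied to the pair [z], 0 of radical vectors with the same value. *)
rewrite -[z]subr0; apply: X_even => //; rewrite ?sub0mx //.
- by apply/IH.
- move=> y /IH yc; rewrite polar_pow (flag_level zc1 yc (evenP ec)).
  by rewrite zP ?mulr0.
- by move=> y _; rewrite polar_pow mul0mx bmx0l.
by rewrite mul0mx qmx0; apply: qz.
Qed.

(** In positive degree, a singular vector orthogonal to [Y a] is a vector of X^(a+1) plus a radical
    vector; the latter is singular, hence 0. *)
Lemma filt_unique c : (X c == filtration_of_flag c)%MS.
Proof.
suff h x : (x <= X c)%MS <-> (x <= filtration_of_flag c)%MS.
  by apply/andP; split; apply/rV_subP => x /h.
case: c => [[|a]|a]; [exact: (filt_unique_neg 0)| |exact: (filt_unique_neg a.+1)].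
have [_ [_ [_ Xperp]]] := X_filt; have [qX perpX] := Xperp a.+1%:Z isT.
rewrite (_ : 1 - _ = - a%:Z) in perpX; last by lia.
have YE : (Y a == perp A (X a.+1))%MS.
  apply/andP; split; apply/rV_subP => y.
    by move=> /filt_unique_neg/perpX h; apply/perpP => z zX; rewrite -bil_qmx h.
  by move=> /perpP h; apply/filt_unique_neg/perpX => z zX; rewrite bil_qmx h.
rewrite /filtration_of_flag; split=> [xX|/(singular_perpP (Y_good a))[xY qx]].
  apply/(singular_perpP (Y_good a)); split; last exact: qX.
  apply/perpP => y; case/andP: YE => YX _ => /submx_trans/(_ YX)/perpP h.
  by rewrite bmxC h.
have : (x <= X a.+1 + radmx A)%MS.
  by rewrite -perp_perp (submx_trans xY) // perpS //; case/andP: YE.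
case/sub_addsmxP => [[d e] /= xE].
have rR : (e *m radmx A <= radmx A)%MS by apply: submxMl.
have re0 : e *m radmx A = 0.
  apply: rad_aniso => //; move: qx; rewrite xE qmxD bmxC.
  by move/radmxP: rR => ->; rewrite addr0 qX ?submxMl // add0r.
by rewrite xE re0 addr0 submxMl.
Qed.

End Uniqueness.
End Flag.

(** * Existence and uniqueness over finite and algebraically closed fields *)

Lemma finite_or_closed_perfect (K : fieldType) : finite_field K \/ alg_closed K ->
  2%:R = 0 :> K -> forall c : K, exists t, t ^+ 2 = c.
Proof.
move=> [[s sP] char2|Kcl _] c; last first.
  have [t] := Kcl 2%N (fun i => if i == 0%N then c else 0) isT.
  rewrite big_ord_recl big_ord1 /= expr0 mulr1 mul0r addr0 => <-.
  by exists t.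
have sq_inj : injective (fun x : K => x ^+ 2).
  move=> x y /= /eqP; rewrite -subr_eq0 => /eqP xy; apply/eqP; rewrite -subr_eq0 -sqrf_eq0.
  rewrite sqrrB -addrA [- _ + _]addrC addrA -mulr_natr char2 mulr0 subr0.
  have -> : y ^+ 2 = - y ^+ 2.
    by apply/eqP; rewrite -addr_eq0 -mulr2n -mulr_natr char2 mulr0.
  by rewrite xy.
have us := undup_uniq s; pose u := undup s.
(* Squaring is injective in characteristic 2, hence surjective on a finite field. *)
have : c \in [seq x ^+ 2 | x <- u].
  have sub : {subset [seq x ^+ 2 | x <- u] <= u} by move=> x _; rewrite mem_undup.
  have uq : uniq [seq x ^+ 2 | x <- u] by rewrite map_inj_uniq.
  have [|_ ->] := uniq_min_size uq sub; first by rewrite size_map.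
  by rewrite mem_undup.
by case/mapP => t _ ->; exists t.
Qed.

Theorem theorem1p7 (K : fieldType) (n : nat) (q : 'rV[K]_n -> K) :
  (finite_field K \/ alg_closed K) -> (2 <= n)%N -> is_qform q -> nondeg q ->
  (forall (X : int -> 'M[K]_n) (N : 'M[K]_n),
     Qfiltration q X -> Estar q X N ->
     unipotent (1%:M + N) /\ SO_Q q (1%:M + N)) /\
  (forall g : 'M[K]_n, unipotent g -> SO_Q q g ->
     exists X : int -> 'M[K]_n,
       (Qfiltration q X /\ Estar q X (g - 1%:M)) /\
       forall X' : int -> 'M[K]_n,
         Qfiltration q X' -> Estar q X' (g - 1%:M) ->
         forall a : int, (X' a == X a)%MS).
Proof.
move=> Kfc n2 qf qnd; set A := qform_mx q.
have qE : q = qmx A by apply: qform_mxE.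
have AE : qform_mx (qmx A) = A by rewrite -qE.
rewrite {}qE in qnd *.
have aniso : anisotropic_rad A.
  move=> x /radmxP xR qx; apply: qnd; rewrite ?qx ?qmx0 // => y.
    by rewrite bil_qmx xR.
  by rewrite bil_qmx bmx0l.
split=> [X N [Xdec [_ [_ Xperp]]] [[[[k Nk] Nq] NX] _]|g gU gSO].
  split; first exact: nilpotent_unipotent Nk.
  have gN : 1%:M + N - 1%:M = N by rewrite addrC addKr.
  have X12 : (X (1 + 2)%R <= X 1)%MS.
    by apply: submx_trans (Xdec 1); apply: (Xdec (1 + 1)).
  have [qX perpX] := Xperp 1 isT.
  (* The orthogonal of X^1 is X^0, and [N] maps X^0 into X^2 and X^1 into X^3, both contained in
     X^1. *)
  apply: (SO_parabolic (U := X 1) (k := k)); rewrite ?gN //.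
  - by move=> x; rewrite mulmxDr mulmx1 qmxD Nq bil_qmx -addrA addNr addr0.
  - rewrite mulmxDr mulmx1 addmx_sub //; apply/row_subP => i; rewrite row_mul.
    by apply: submx_trans X12; apply: NX; apply: row_sub.
  apply/row_subP => i; rewrite row_mul.
  have : (row i (perp A (X 1)) <= X 0)%MS.
    rewrite -[X 0]/(X (1 - 1)%R); apply/perpX => y y1.
    by have /perpP h := row_sub i (perp A (X 1)); rewrite bil_qmx h.
  move=> /NX h; apply: submx_trans h _; exact: (Xdec 1).
have N_nil := unipotent_nilpotent (ltnW n2) gU.
have gO : O_Q (qmx A) g.
  case: Kfc => h; first by case: (gSO.2 h).
  by have [T [TS [_ [Tg _]]]] := gSO.1 h; apply: TS.
set N := g - 1%:M in N_nil *; have gE : g = 1%:M + N by rewrite addrC subrK.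
have N_isom x : qmx A (x *m N) = - bmx A x (x *m N).
  have := gO.2 x; rewrite gE mulmxDr mulmx1 qmxD => h.
  apply/eqP; rewrite -addr_eq0; apply/eqP.
  by apply: (addrI (qmx A x)); rewrite addrA h addr0.
have [|Y [Yg Ys Yf]] := flag_exists N_isom N_nil.
  move=> a Y gY; have [oa|ea] := boolP (odd a.+1).
    exact: (good_step_odd aniso N_isom N_nil _ gY).
  have [char2|n_char2] := eqVneq (2%:R : K) 0; last first.
    exact: (good_step_neq2 aniso N_isom N_nil _ gY).
  have [lt2|] := ltnP 2 a.+1; first exact: (good_step_even aniso N_isom N_nil _ gY).
  (* Only the level 2 in characteristic 2 remains; this is where [g] must lie in [SO_Q] and not just
     in [O_Q]. *)
  case: a ea gY => [|[|a]] // _ gY _.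
  apply: (good_step_two aniso N_isom N_nil gY) => //.
  - exact: finite_or_closed_perfect.
  - by move=> h; apply: dickson_SO.
  by rewrite -gE.
exists (filtration_of_flag A Y); split; first split.
- exact: (filt_Qfiltration aniso Yg Ys Yf).
- exact: (filt_Estar N_isom N_nil Yg Ys).
by move=> X' X'f X's a; apply: (filt_unique aniso N_isom N_nil Yg Ys Yf).
Qed.
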